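(* Let $A$ be an integer $d\times n$ matrix with columns $a_1,\dots,a_n\in\mathbb{Z}^d$ and $\operatorname{rank}A=d<n$, let $b\in\mathbb{Z}^d$, and let $P=\{x=(\xi_1,\dots,\xi_n)\in\mathbb{R}^n: Ax=b,\ 0\le\xi_j\le1\ (j=1,\dots,n)\}$, assumed non-empty. Assume $A(\mathbb{Z}^n)=\mathbb{Z}^d$. Let $z=(\zeta_1,\dots,\zeta_n)$ be the unique point of $P$ maximizing $$h(x)=\sum_{j=1}^n\Big(\xi_j\ln\frac1{\xi_j}+(1-\xi_j)\ln\frac1{1-\xi_j}\Big),$$ and let $B$ be the $d\times n$ matrix whose $j$-th column is $(\zeta_j-\zeta_j^2)^{1/2}a_j$. Let $q:\mathbb{R}^d\to\mathbb{R}$, $q(t)=\frac12\sum_{j=1}^n(\zeta_j-\zeta_j^2)\langle a_j,t\rangle^2$. For $i=1,\dots,d$ let $Y_i\subset\mathbb{Z}^n$ be a non-empty finite set with $Ay=e_i$ for all $y\in Y_i$, and let $\psi_i(x)=\frac1{|Y_i|}\sum_{y\in Y_i}\langle y,x\rangle^2$ for $x\in\mathbb{R}^n$. Suppose that for some $\lambda>0$, $q(t)\ge\lambda\|t\|^2$ for all $t\in\mathbb{R}^d$; that for some $\rho>0$, $\psi_i(x)\le\rho\|x\|^2$ for all $x\in\mathbb{R}^n$ and $i=1,\dots,d$; that for some $\theta\ge1$, $\|a_j\|_1\le\theta\sqrt{\zeta_j(1-\zeta_j)}$ for $j=1,\dots,n$; and that for some $0<\alpha\le1/4$, $\zeta_j(1-\zeta_j)\ge\alpha$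 for $j=1,\dots,n$. Then there is an absolute constant $\gamma>0$ such that for any $0<\epsilon\le1/2$, as long as $$\lambda\ge\gamma\epsilon^{-2}\theta^2\Big(d+\ln\frac1\epsilon\Big)^2\ln\Big(\frac n\epsilon\Big),$$ we have $$|P\cap\{0,1\}^n|=e^{h(z)}\left(\frac{\kappa}{(2\pi)^{d/2}(\det BB^T)^{1/2}}+\Delta\right)$$ where $1-\epsilon\le\kappa\le1+\epsilon$ and $|\Delta|\le\exp\left\{-\frac{\alpha}{80\theta^2\rho}\right\}$.
   Context: $e_1,\dots,e_d$ is the standard basis of $\mathbb{Z}^d$; $\langle\cdot,\cdot\rangle$ is the standard scalar product, $\|\cdot\|$ the Euclidean norm, and $\|t\|_1=\sum_i|\tau_i|$. $\{0,1\}^n$ is the set of vectors in $\mathbb{R}^n$ with all coordinates in $\{0,1\}$. The function $h$ is strictly concave on the unit cube, so its maximizer on $P$ is unique. *)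

(* Defs.v *)
From HB Require Import structures.
From mathcomp Require Import all_boot all_order all_algebra finmap.
From mathcomp Require Import all_classical all_reals all_analysis.
Set Implicit Arguments.
Unset Strict Implicit.
Unset Printing Implicit Defensive.
Import Order.TTheory GRing.Theory Num.Theory.
Local Open Scope classical_set_scope.
Local Open Scope ring_scope.

Definition toreal (R : realType) (m n : nat) (A : 'M[int]_(m, n)) : 'M[R]_(m, n) :=
  map_mx intr A.

Definition dotp (R : realType) (m : nat) (x y : 'cV[R]_m) : R :=
  \sum_(i < m) x i ord0 * y i ord0.

(* The library norm `|x| on matrices is the sup norm, hence the explicit
   Euclidean and l1 norms. *)
Definition norm2 (R : realType) (m : nat) (x : 'cV[R]_m) : R :=
  Num.sqrt (dotp x x).

Definition norm1 (R : realType) (m : nat) (x : 'cV[R]_m) : R :=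
  \sum_(i < m) `|x i ord0|.

Definition polytope01 (R : realType) (d n : nat)
    (A : 'M[int]_(d, n)) (b : 'cV[int]_d) : set 'cV[R]_n :=
  [set x | toreal R A *m x = toreal R b /\
           forall j, 0 <= x j ord0 <= 1].

Arguments polytope01 R {d n} A b.

Definition vectors01 (R : realType) (n : nat) : set 'cV[R]_n :=
  [set x | forall j, x j ord0 = 0 \/ x j ord0 = 1].

Arguments vectors01 : clear implicits.

(* fset_set sends infinite sets to fset0; this guarantees that
   #|` fset_set (polytope01 R A b `&` vectors01 R n)| is a genuine cardinality. *)
Lemma finite_vectors01 (R : realType) (n : nat) :
  finite_set (vectors01 R n).
Proof.
apply: (@sub_finite_set _ _
  ((fun v : 'cV[bool]_n => \col_j ((v j ord0)%:R : R)) @` [set: 'cV[bool]_n])).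
  move=> x x01; exists (\col_j (x j ord0 == 1)) => //.
  apply/colP => j; rewrite !mxE.
  by case: (x01 j) => ->; rewrite ?eqxx // eq_sym oner_eq0.
exact/finite_image/finite_finset.
Qed.

(* At 0 and 1 the convention 0 * ln (1 / 0) = 0 holds, because 0^-1 = 0. *)
Definition entropy (R : realType) (n : nat) (x : 'cV[R]_n) : R :=
  \sum_(j < n) (x j ord0 * ln (1 / x j ord0)
                + (1 - x j ord0) * ln (1 / (1 - x j ord0))).

Definition scaledmx (R : realType) (d n : nat) (A : 'M[int]_(d, n))
    (z : 'cV[R]_n) : 'M[R]_(d, n) :=
  \matrix_(i, j) (Num.sqrt (z j ord0 - z j ord0 ^+ 2) * toreal R A i j).

Definition qform (R : realType) (d n : nat) (A : 'M[int]_(d, n))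
    (z : 'cV[R]_n) (t : 'cV[R]_d) : R :=
  2^-1 * \sum_(j < n)
    (z j ord0 - z j ord0 ^+ 2) * dotp (col j (toreal R A)) t ^+ 2.

Definition psi (R : realType) (n : nat) (Y : {fset 'cV[int]_n})
    (x : 'cV[R]_n) : R :=
  (#|` Y|%:R)^-1 * \sum_(y <- Y) dotp (toreal R y) x ^+ 2.

(* Main.v *)
(** The entropy maximizer [z] is the mean vector of independent Bernoulli
    variables X_j; by stationarity their joint law is constant, equal to
    [exp (- h z)], on the 0-1 points of P, so the number of these points is
    [exp (h z) * Pr (A X = b)].  This probability is given by Fourier inversion.
    Since A X is integral and bounded, the inversion formula is an exact
    identity between finite sums over a grid of spacing [2 pi / (2 K + 1)] in the
    cube, for all large K, so that no integral over R^d is needed: a Gaussian sum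
    over a fine grid is computed one coordinate at a time, completing the square
    (Schur complement) and comparing a one-dimensional sum with an integral.

    Outside the box of half-side [1 / (2 theta)] the vectors of Y_i force the
    residues of the [<a_j, t>] modulo 2 pi to be large, and the characteristic
    function is at most [exp (- alpha / (80 theta^2 rho))].  Inside the box it is
    compared factor by factor with [exp (- q)]: the error is of order
    [q * max_j |<a_j, t>| * exp (- q)] where q and all the [|<a_j, t>|] are small,
    and elsewhere Gaussian tails suffice. *)
Require Import Defs.
From mathcomp Require Import all_boot all_order all_algebra finmap.
From mathcomp Require Import all_classical all_reals all_analysis.
From mathcomp Require Import measurable_realfun.
From mathcomp Require Import ring lra zify.
From mathcomp.real_closed Require Import complex.
Set Implicit Arguments.
Unset Strict Implicit.
Unset Printing Implicit Defensive.
Import Order.TTheory GRing.Theory Num.Theory.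
Import numFieldNormedType.Exports.
Local Open Scope classical_set_scope.
Local Open Scope ring_scope.

(** * One-dimensional Gaussian sums *)

(** Every error is brought to one shape, a grid sum of [exp (<u, t> - q t)]; completing the square
    bounds it by the Gaussian mass times the exponential of any upper bound of the exponent. Hence
    the linear term in the Gaussian lemmas: a condition such as [|<a_k, t>| > M] is replaced by an
    exponential majorant with both signs. The obstacle is that inversion ties spacing to extent,
    [h K < pi], so the grid never leaves a fixed cube. Upper bounds therefore hold below a threshold
    on [h] that depends on neither [K] nor [u]; the lower bound needs a grid of large extent and
    reaches the cube through functions supported in the box. Put [L = d + ln (1 / eps)] and
    [Lam = ln (n / eps)]. As [d <= L], scaling q by [1 - 1 / (4 L)] costs a bounded factor in the
    Gaussian mass and halving q costs at most [exp L]. The cutoff [M = eps / (2^9 L)] makes the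
    central error a small multiple of eps. With [tau = 8 Lam / M], the n tails beyond the cutoff are
    negligible once [lambda >= 16 theta^2 Lam / M^2], which is the hypothesis with
    [gamma = 2^22]. *)

Section OneDim.
Context {R : realType}.
Implicit Types (a b c h w x y : R).

Let mu := @lebesgue_measure R.

Definition gauss_seg a b : R := \int[mu]_(t in `]a, b]) gauss_fun t.

Lemma gauss_integrable a b : mu.-integrable `]a, b] (EFin \o gauss_fun).
Proof. by apply: integrableS integrableT_gauss. Qed.

Lemma gauss_segD a b c : a <= b -> b <= c ->
  gauss_seg a b + gauss_seg b c = gauss_seg a c.
Proof.
move=> ab bc; apply/esym/eqP; rewrite addrC -subr_eq; apply/eqP.
by apply: Rintegral_itvB; rewrite ?bnd_simp//; exact: gauss_integrable.
Qed.

Lemma gauss_seg_le a b : gauss_seg a b <= Num.sqrt pi.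
Proof.
rewrite -lee_fin -integralT_gauss /gauss_seg /Rintegral fineK; last first.
  by apply: integrable_fin_num => //; exact: gauss_integrable.
apply: ge0_subset_integral => //.
- by apply/measurable_EFinP; exact: measurable_gauss_fun.
- by move=> x _; rewrite lee_fin gauss_fun_ge0.
Qed.

Lemma gauss_seg_ge0 a b : 0 <= gauss_seg a b.
Proof. by apply: Rintegral_ge0 => x _; exact: gauss_fun_ge0. Qed.

(** Monotone convergence along the segments []-i, i]]; enlarging a segment only adds nonnegative
    pieces. *)
Lemma gauss_seg_cvg (eta : R) : 0 < eta ->
  exists2 X : R, 0 <= X & forall a b, a <= - X -> X <= b ->
    Num.sqrt pi - eta <= gauss_seg a b.
Proof.
move=> eta0.
have : (\int[mu]_(x in `](- i%:R)%R, i%:R%R]%classic) (gauss_fun x)%:E @[i --> \oo] -->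
    \int[mu]_(x in \bigcup_i `](- (i : nat)%:R)%R, (i : nat)%:R%R]%classic)
      (gauss_fun x : R)%:E)%E.
  apply: ge0_nondecreasing_set_cvg_integral => //.
  - move=> i j ij; rewrite subsetEset => x /=; rewrite !in_itv/=.
    move=> /andP[ix xi]; rewrite (le_lt_trans _ ix) ?lerN2 ?ler_nat//=.
    by rewrite (le_trans xi)// ler_nat.
  - move=> i; apply/measurable_funTS/measurable_EFinP.
    exact: measurable_gauss_fun.
  - by move=> i x _; rewrite lee_fin gauss_fun_ge0.
have -> : \bigcup_i `](- (i : nat)%:R), (i : nat)%:R]%classic = [set: R].
  apply/seteqP; split=> // x _; exists (Num.bound `|x|) => //=.
  have : `|x| < (Num.bound `|x|)%:R by exact: archi_boundP.
  by rewrite in_itv/= ltr_norml => /andP[-> /ltW ->].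
rewrite integralT_gauss.
rewrite (_ : (fun i : nat => _) = (fun i => (gauss_seg (- i%:R) i%:R)%:E)).
  move/fine_cvgP => [_ /cvgrPdist_le] /(_ _ eta0) [N _ /(_ N (leqnn _))].
  rewrite /= => HN; exists N%:R => // a b aN bN.
  have NN : - N%:R <= N%:R :> R by rewrite (@le_trans _ _ 0) ?oppr_le0.
  have := gauss_segD aN (le_trans NN bN); have := gauss_segD NN bN.
  have := gauss_seg_ge0 a (- N%:R); have := gauss_seg_ge0 N%:R b.
  by move: HN; rewrite ler_norml => /andP[_]; lra.
apply/funext => i; rewrite /gauss_seg /Rintegral fineK//.
by apply: integrable_fin_num => //; exact: gauss_integrable.
Qed.

(* the total variation of [gauss_fun] on ]-oo, x] *)
Definition gauss_var x : R := if x <= 0 then gauss_fun x else 2 - gauss_fun x.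

Lemma gauss_fun_mono x y : `|x| <= `|y| -> gauss_fun y <= gauss_fun x.
Proof. by move=> xy; rewrite /gauss_fun ler_expR lerN2 -(real_normK (num_real x))
  -(real_normK (num_real y)) lerXn2r ?nnegrE. Qed.

Lemma gauss_var_dist x y : x <= y ->
  `|gauss_fun y - gauss_fun x| <= gauss_var y - gauss_var x.
Proof.
move=> xy; rewrite /gauss_var.
have g1 := @gauss_fun_le1 R.
case: (lerP y 0) => y0; case: (lerP x 0) => x0.
- have := @gauss_fun_mono y x; rewrite (ler0_norm x0) (ler0_norm y0) lerN2 => /(_ xy) H.
  by rewrite ger0_norm ?subr_ge0.
- by have := le_lt_trans y0 (lt_le_trans x0 xy); rewrite ltxx.
(* Here [x <= 0 < y]: the bound is [2 - gauss_fun y - gauss_fun x], and both values are at most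
   1. *)
- by have := g1 x; have := g1 y; have := gauss_fun_ge0 x;
    have := gauss_fun_ge0 y; rewrite ler_norml; lra.
- have := @gauss_fun_mono x y.
  rewrite (gtr0_norm x0) (gtr0_norm y0) => /(_ xy) H; rewrite distrC ger0_norm; lra.
Qed.

Lemma gauss_var_bound x y : gauss_var x - gauss_var y <= 2.
Proof.
have g1 := @gauss_fun_le1 R; have g0 := @gauss_fun_ge0 R.
by rewrite /gauss_var; have := g1 x; have := g1 y; have := g0 x; have := g0 y;
  case: ifP => _; case: ifP => _; lra.
Qed.

Lemma gauss_seg_approx x h : 0 <= h ->
  `|h * gauss_fun x - gauss_seg (x - h) x| <=
  h * (gauss_var x - gauss_var (x - h)).
Proof.
move=> h0; set V := _ - gauss_var _.
have xhx : x - h <= x by lra.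
have mS : fine (mu `]x - h, x]) = h.
  rewrite /mu lebesgue_measure_itv/= lte_fin; case: ltP => //= H; lra.
have cint c : mu.-integrable `]x - h, x] (EFin \o cst c).
  apply/integrableP; split; first by apply/measurable_EFinP; exact: measurable_cst.
  rewrite /= integral_cst//= /mu lebesgue_measure_itv/= lte_fin.
  by case: ifP => _; rewrite -?EFinB -?EFinM ltry.
have dist t : `]x - h, x]%classic t -> `|gauss_fun x - gauss_fun t| <= V.
  rewrite /= in_itv/= => /andP[xt tx]; apply: le_trans (gauss_var_dist tx) _.
  rewrite lerB//.
  have := gauss_var_dist (ltW xt).
  by have := normr_ge0 (gauss_fun t - gauss_fun (x - h)); lra.
have up : gauss_seg (x - h) x <= (gauss_fun x + V) * h.
  rewrite -[X in _ * X]mS -Rintegral_cst//; apply: le_Rintegral => //.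
  - exact: gauss_integrable.
  - exact: cint.
  - by move=> t /dist; rewrite ler_norml => /andP[]; lra.
have lo : (gauss_fun x - V) * h <= gauss_seg (x - h) x.
  rewrite -[X in _ * X]mS -Rintegral_cst//; apply: le_Rintegral => //.
  - exact: cint.
  - exact: gauss_integrable.
  - by move=> t /dist; rewrite ler_norml => /andP[]; lra.
by rewrite ler_norml; apply/andP; split; lra.
Qed.

(** The errors of [gauss_seg_approx] telescope into a total variation, so the bound does not grow
    with [N]. Each node is the right end of its cell, hence the start at [c - h]. *)
Lemma gauss_riemann c h N : 0 <= h ->
  `|h * (\sum_(k < N) gauss_fun (c + h * k%:R))
     - gauss_seg (c - h) (c - h + h * N%:R)| <= 2 * h.
Proof.
move=> h0.
suff : `|h * (\sum_(k < N) gauss_fun (c + h * k%:R))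
     - gauss_seg (c - h) (c - h + h * N%:R)| <=
   h * (gauss_var (c - h + h * N%:R) - gauss_var (c - h)).
  move=> H; apply: le_trans H _; rewrite mulrC.
  by apply: ler_wpM2r => //; exact: gauss_var_bound.
elim: N => [|N IH].
  rewrite big_ord0 !mulr0 addr0 subrr mulr0 /gauss_seg.
  by rewrite set_itv_ge ?bnd_simp ?ltxx// Rintegral_set0 subrr normr0.
rewrite big_ord_recr/= mulrDr.
set x := c - h + h * N%:R in IH *.
have -> : c - h + h * N.+1%:R = c + h * N%:R by rewrite -natr1; ring.
have xE : x = c + h * N%:R - h by rewrite /x; ring.
set y := c + h * N%:R in xE *.
have hN : 0 <= h * N%:R by rewrite mulr_ge0.
have ? : c - h <= x by rewrite /x; lra.
have ? : x <= y by lra.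
rewrite -(@gauss_segD (c - h) x y)//.
have := gauss_seg_approx y h0; rewrite -xE => H2.
rewrite opprD addrACA; apply: le_trans (ler_normD _ _) _.
by have := lerD IH H2; lra.
Qed.

End OneDim.

(** * Rescaled and shifted one-dimensional Gaussian sums *)

Section OneDimScaled.
Context {R : realType}.
Implicit Types (a b c h w x y : R).

Lemma gauss_riemann_scaled a h w K r N : 0 < a -> 0 <= h ->
  r = Num.sqrt (a / 2) ->
  `|r * (h * (\sum_(k < N) expR (- (a / 2 * (h * (k%:R - K) + w) ^+ 2))))
     - gauss_seg (r * (w - h * K) - r * h)
        (r * (w - h * K) - r * h + r * h * N%:R)| <= 2 * (r * h).
Proof.
move=> a0 h0 rE; have r0 : 0 <= r by rewrite rE sqrtr_ge0.
have := @gauss_riemann R (r * (w - h * K)) (r * h) N (mulr_ge0 r0 h0).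
suff -> : \sum_(k < N) expR (- (a / 2 * (h * (k%:R - K) + w) ^+ 2)) =
    \sum_(k < N) gauss_fun (r * (w - h * K) + r * h * k%:R).
  by rewrite [r * (h * _)]mulrA.
apply: eq_bigr => k _; rewrite /gauss_fun; congr (expR (- _)).
have -> : a / 2 = r ^+ 2 by rewrite rE sqr_sqrtr// divr_ge0// ltW.
ring.
Qed.

Lemma sqrt_2pi_div a : 0 < a ->
  Num.sqrt (2 * pi / a) = Num.sqrt pi / Num.sqrt (a / 2) :> R.
Proof.
move=> a0; rewrite -sqrtrV ?divr_ge0 ?ltW// -sqrtrM ?pi_ge0// invf_div.
by rewrite mulrCA mulrA.
Qed.

Lemma gauss_sum_le a h w K N : 0 < a -> 0 <= h ->
  h * (\sum_(k < N) expR (- (a / 2 * (h * (k%:R - K) + w) ^+ 2))) <=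
  Num.sqrt (2 * pi / a) + 2 * h.
Proof.
move=> a0 h0; rewrite sqrt_2pi_div//.
have r0 : 0 < Num.sqrt (a / 2) by rewrite sqrtr_gt0 divr_gt0.
have := gauss_riemann_scaled w K N a0 h0 erefl.
set r := Num.sqrt (a / 2) in r0 *; set S := h * \sum_(_ < _) _.
rewrite ler_norml => /andP[_].
have := gauss_seg_le (r * (w - h * K) - r * h)
  (r * (w - h * K) - r * h + r * h * N%:R).
set J := gauss_seg _ _ => H1 H2.
rewrite -(ler_pM2l r0) mulrDr [r * (_ / r)]mulrC divfK ?gt_eqF//.
by nra.
Qed.

(** Unlike the upper bound, this one needs the grid to extend far enough on both sides of the
    shifted centre [- w]. The threshold [X] depends on neither [h] nor [w]. *)
Lemma gauss_sum_ge a eta : 0 < a -> 0 < eta ->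
  exists2 X, 0 <= X & forall h w (K : nat), 0 <= h -> X + `|w| <= h * K%:R ->
  Num.sqrt (2 * pi / a) - 2 * h - eta <=
  h * (\sum_(k < K.*2.+1) expR (- (a / 2 * (h * (k%:R - K%:R) + w) ^+ 2))).
Proof.
move=> a0 eta0; rewrite sqrt_2pi_div//.
have r0 : 0 < Num.sqrt (a / 2) by rewrite sqrtr_gt0 divr_gt0.
set r := Num.sqrt (a / 2) in r0 *.
have re0 : 0 < r * eta by rewrite mulr_gt0.
have [X X0 HX] := gauss_seg_cvg re0.
exists (X / r) => [|h w K h0 hK]; first by rewrite divr_ge0// ltW.
have := gauss_riemann_scaled w K%:R K.*2.+1 a0 h0 erefl; rewrite -/r.
set S := h * \sum_(_ < _) _; rewrite ler_norml => /andP[H1 _].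
have XE : r * (X / r) = X by rewrite mulrC divfK// gt_eqF.
have hK' : X + r * `|w| <= r * h * K%:R.
  by move: hK; rewrite -(ler_pM2l r0) mulrDr XE mulrA.
have w1 : w <= `|w| := ler_norm w.
have w2 : - w <= `|w| by rewrite -normrN ler_norm.
have rw1 := ler_wpM2l (ltW r0) w1; have rw2 := ler_wpM2l (ltW r0) w2.
have rh : 0 <= r * h by rewrite mulr_ge0// ltW.
have := HX (r * (w - h * K%:R) - r * h)
  (r * (w - h * K%:R) - r * h + r * h * K.*2.+1%:R).
have NE : K.*2.+1%:R = 2 * K%:R + 1 :> R by rewrite -natr1 -mul2n natrM.
move: H1; rewrite !NE; set J := gauss_seg _ _ => H1 HJ.
have HJ' : Num.sqrt pi - r * eta <= J by apply: HJ; lra.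
rewrite -(ler_pM2l r0) !mulrDr !mulrN [r * (_ / r)]mulrC divfK ?gt_eqF//.
lra.
Qed.

End OneDimScaled.

(** * Taylor estimates *)

Section Taylor.
Context {R : realType}.
Implicit Types x y s z v : R.

(** Up to [cos_le_taylor4], each Taylor inequality is integrated into the next by this lemma;
    multiplying by a factorial keeps the coefficients integral. *)
Lemma ge0_of_deriv_ge0 (f f' : R -> R) x : (forall y, is_derive y 1 f (f' y)) ->
  f 0 = 0 -> (forall y, 0 <= y -> 0 <= f' y) -> 0 <= x -> 0 <= f x.
Proof.
move=> df f0 f'0; rewrite le_eqVlt => /predU1P[<-|x0]; first by rewrite f0.
have cf : {within `[0, x], continuous f}.
  apply: continuous_subspaceT => y; apply: differentiable_continuous.
  exact/derivable1_diffP/(@ex_derive _ _ _ _ _ _ _ (df y)).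
have [c] := @MVT R f f' 0 x x0 (fun y _ => df y) cf.
rewrite in_itv/= f0 !subr0 => /andP[c0 _] ->.
by rewrite mulr_ge0 ?f'0 ?ltW.
Qed.

Lemma sin_le x : 0 <= x -> sin x <= x.
Proof.
move=> x0; rewrite -subr_ge0.
apply: (@ge0_of_deriv_ge0 (fun y => y - sin y) (fun y => 1 - cos y)) => //.
by rewrite sin0 subr0.
Qed.

Lemma cos_ge_taylor2_nneg x : 0 <= x -> 1 - x ^+ 2 / 2 <= cos x.
Proof.
move=> x0; suff : 0 <= 2 * cos x - 2 + x ^+ 2 by lra.
apply: (@ge0_of_deriv_ge0 (fun y => 2 * cos y - 2 + y ^+ 2)
  (fun y => 2 * (y - sin y))) => //.
- by move=> y; apply: is_derive_eq; rewrite /GRing.scale/=; ring.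
- by rewrite cos0; ring.
- by move=> y y0; rewrite mulr_ge0// subr_ge0 sin_le.
Qed.

Lemma sin_ge_taylor3 x : 0 <= x -> x - x ^+ 3 / 6 <= sin x.
Proof.
move=> x0; suff : 0 <= 6 * sin x - 6 * x + x ^+ 3 by lra.
apply: (@ge0_of_deriv_ge0 (fun y => 6 * sin y - 6 * y + y ^+ 3)
  (fun y => 6 * cos y - 6 + 3 * y ^+ 2)) => //.
- by move=> y; apply: is_derive_eq; rewrite /GRing.scale/=; ring.
- by rewrite sin0; ring.
- by move=> y /cos_ge_taylor2_nneg; lra.
Qed.

Lemma cos_le_taylor4 x : cos x <= 1 - x ^+ 2 / 2 + x ^+ 4 / 24.
Proof.
wlog x0 : x / 0 <= x.
  move=> H; case: (lerP 0 x) => [/H//|x0].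
  have := H (- x); rewrite oppr_ge0 cosN sqrrN => /(_ (ltW x0)).
  by rewrite (_ : (- x) ^+ 4 = x ^+ 4)//; ring.
suff : 0 <= 24 - 12 * x ^+ 2 + x ^+ 4 - 24 * cos x by lra.
apply: (@ge0_of_deriv_ge0 (fun y => 24 - 12 * y ^+ 2 + y ^+ 4 - 24 * cos y)
  (fun y => 4 * (6 * sin y - 6 * y + y ^+ 3))) => //.
- by move=> y; apply: is_derive_eq; rewrite /GRing.scale/=; ring.
- by rewrite cos0; ring.
- by move=> y /sin_ge_taylor3; lra.
Qed.

Lemma cos_ge_taylor2 x : 1 - x ^+ 2 / 2 <= cos x.
Proof.
case: (lerP 0 x) => [/cos_ge_taylor2_nneg//|/ltW x0].
by rewrite -cosN -sqrrN cos_ge_taylor2_nneg// oppr_ge0.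
Qed.

Lemma sin_taylor_dist x : `|sin x - x| <= `|x| ^+ 3 / 6.
Proof.
wlog x0 : x / 0 <= x.
  move=> H; case: (lerP 0 x) => [/H//|/ltW x0].
  by have := H (- x); rewrite oppr_ge0 sinN normrN -opprD normrN; apply.
have := sin_le x0; have := sin_ge_taylor3 x0; rewrite (ger0_norm x0) ler_norml; lra.
Qed.

(** With [y = x / 2 <= 2], the cubic bound gives [sin y >= y / 3], so
    [1 - cos x = 2 sin^2 y >= x^2 / 18]. The weaker 20, multiplied by the 4 in [(1 / (2 theta))^2],
    is the 80 of the theorem. *)
Lemma one_sub_cos_ge x : `|x| <= pi -> x ^+ 2 / 20 <= 1 - cos x.
Proof.
wlog x0 : x / 0 <= x.
  move=> H; case: (lerP 0 x) => [/H//|/ltW x0].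
  by have := H (- x); rewrite oppr_ge0 cosN sqrrN normrN; apply.
rewrite ger0_norm// => xpi.
have x4 : x <= 4 by have := @pihalf_lt2 R; lra.
have -> : x = (x / 2) *+ 2 by rewrite -mulr_natr divfK.
set y := x / 2; have y0 : 0 <= y by rewrite divr_ge0.
have y2 : y <= 2 by rewrite /y; lra.
rewrite cos_mulr2n cos2sin2.
have : y / 3 <= sin y.
  apply: le_trans (sin_ge_taylor3 y0).
  have : 0 <= y * (4 - y ^+ 2) by rewrite mulr_ge0//; nra.
  have -> : y * (4 - y ^+ 2) = 4 * y - y ^+ 3 by ring.
  lra.
move=> H; have : (y / 3) ^+ 2 <= sin y ^+ 2.
  by rewrite lerXn2r// nnegrE ?(le_trans _ H)// divr_ge0.
have := sqr_ge0 y; rewrite !mulr2n; lra.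
Qed.

Lemma expRN_taylor_dist y : 0 <= y -> `|expR (- y) - (1 - y)| <= y ^+ 2 / 2.
Proof.
move=> y0; have := expR_ge1Dx (- y).
have : 0 <= 2 - 2 * y + y ^+ 2 - 2 * expR (- y).
  apply: (@ge0_of_deriv_ge0 (fun y => 2 - 2 * y + y ^+ 2 - 2 * expR (- y))
    (fun y => 2 * (expR (- y) - (1 - y)))) => //.
  - by move=> z; apply: is_derive_eq; rewrite /GRing.scale/=; ring.
  - by rewrite oppr0 expR0; ring.
  - by move=> z _; have := expR_ge1Dx (- z); lra.
rewrite ler_norml; lra.
Qed.

End Taylor.

(** * Bernoulli characteristic functions *)

Section ComplexFactors.
Context {R : realType}.
Implicit Types x y s z : R.
Local Notation C := R[i].
Local Notation "x %:C" := (real_complex R x).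

Definition expi x : C := Complex (cos x) (sin x).

Lemma expi0 : expi 0 = 1.
Proof. by rewrite /expi cos0 sin0. Qed.

Lemma expiD x y : expi (x + y) = expi x * expi y.
Proof.
by apply/eqP; rewrite eq_complex /= cosD sinD [cos x * sin y + _]addrC !eqxx.
Qed.

Lemma expi_sum (I : Type) (r : seq I) (P : pred I) (f : I -> R) :
  expi (\sum_(i <- r | P i) f i) = \prod_(i <- r | P i) expi (f i).
Proof. exact: (big_morph expi expiD expi0). Qed.

Lemma expiM_nat x n : expi (x * n%:R) = expi x ^+ n.
Proof.
elim: n => [|n IH]; first by rewrite mulr0 expi0 expr0.
by rewrite -natr1 mulrDr mulr1 expiD IH exprSr.
Qed.

Lemma expi2pi_nat n : expi (2 * pi * n%:R) = 1.
Proof.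
by rewrite expiM_nat /expi mulr2n mulrDl mul1r -mulr2n cos2pi sin2pi expr1n.
Qed.

Lemma normc_ge0 (a : C) : 0 <= Normc.normc a.
Proof. by case: a => *; exact: sqrtr_ge0. Qed.

Lemma normc_real x : Normc.normc x%:C = `|x|.
Proof. by rewrite /= expr0n addr0 sqrtr_sqr. Qed.

Lemma normc_le_add (a b : R) : Normc.normc (Complex a b) <= `|a| + `|b|.
Proof.
rewrite -[leRHS]ger0_norm ?addr_ge0// -sqrtr_sqr /= ler_sqrt ?sqr_ge0//.
have := mulr_ge0 (normr_ge0 a) (normr_ge0 b).
rewrite sqrrD !real_normK ?num_real// mulr2n; lra.
Qed.

Lemma normc_prod (I : Type) (r : seq I) (P : pred I) (f : I -> C) :
  Normc.normc (\prod_(i <- r | P i) f i) =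
  \prod_(i <- r | P i) Normc.normc (f i).
Proof. by apply: (big_morph _ (@Normc.normcM R)); exact: Normc.normc1. Qed.

Lemma normc_sum_le (I : Type) (r : seq I) (P : pred I) (f : I -> C) :
  Normc.normc (\sum_(i <- r | P i) f i) <=
  \sum_(i <- r | P i) Normc.normc (f i).
Proof.
elim/big_rec2: _ => [|i a b _ H]; first by rewrite Normc.normc0.
by apply: le_trans (le_normcD _ _) _; rewrite lerD2l.
Qed.

(* the characteristic function of a centred Bernoulli variable of mean z *)
Definition bernoulli_cf z s : C :=
  (1 - z)%:C * expi (- (z * s)) + z%:C * expi ((1 - z) * s).

(** The squared modulus is exactly [1 - 2 z (1 - z) (1 - cos s)], to which [1 + x <= exp x]
    applies. *)
Lemma normc_bernoulli_cf z s : 0 <= z <= 1 ->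
  Normc.normc (bernoulli_cf z s) <= expR (- (z * (1 - z) * (1 - cos s))).
Proof.
move=> /andP[z0 z1]; set E := expR _.
rewrite -[leRHS]ger0_norm ?expR_ge0// -sqrtr_sqr /= ler_sqrt ?sqr_ge0//.
have -> : ((1 - z) * cos (- (z * s)) - 0 * sin (- (z * s)) +
   (z * cos ((1 - z) * s) - 0 * sin ((1 - z) * s))) ^+ 2 +
  ((1 - z) * sin (- (z * s)) + 0 * cos (- (z * s)) +
   (z * sin ((1 - z) * s) + 0 * cos ((1 - z) * s))) ^+ 2 =
  1 - 2 * (z * (1 - z) * (1 - cos s)).
  have -> : cos s = cos ((1 - z) * s) * cos (z * s) - sin ((1 - z) * s) * sin (z * s).
    by rewrite -cosD; congr cos; ring.
  rewrite cosN sinN.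
  have := cos2Dsin2 (z * s); have := cos2Dsin2 ((1 - z) * s).
  set c1 := cos (z * s); set s1 := sin (z * s).
  set c2 := cos (_ * s); set s2 := sin (_ * s) => H2 H1.
  have {}H1 : s1 ^+ 2 = 1 - c1 ^+ 2 by lra.
  have {}H2 : s2 ^+ 2 = 1 - c2 ^+ 2 by lra.
  transitivity ((1 - z) ^+ 2 * (c1 ^+ 2 + s1 ^+ 2) + z ^+ 2 * (c2 ^+ 2 + s2 ^+ 2)
    + 2 * z * (1 - z) * (c2 * c1 - s2 * s1)); first ring.
  by rewrite H1 H2; ring.
rewrite /E -expRM_natl.
by apply: le_trans (expR_ge1Dx _); lra.
Qed.

(** [5 / 24] is [1 / 24] from the cosine plus [1 / 6] from the sine, using [x^4 <= |x|^3]. *)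
Lemma expi_taylor x : `|x| <= 1 ->
  Normc.normc (expi x - Complex (1 - x ^+ 2 / 2) x) <= 5 / 24 * `|x| ^+ 3.
Proof.
move=> x1; apply: le_trans (normc_le_add _ _) _.
have c1 := cos_le_taylor4 x; have c2 := cos_ge_taylor2 x.
have x43 : x ^+ 4 <= `|x| ^+ 3.
  rewrite -(@ger0_norm _ (x ^+ 4)) ?exprn_even_ge0// normrX exprSr.
  by rewrite ler_piMr// exprn_ge0.
have := sin_taylor_dist x.
have : `|cos x - (1 - x ^+ 2 / 2)| <= `|x| ^+ 3 / 24.
  by rewrite ger0_norm; lra.
lra.
Qed.

(** Centring cancels the linear terms, and the quadratic ones add up to [v s^2 / 2]. The cubic
    remainders carry [(1 - z) z^3 + z (1 - z)^3 = v (z^2 + (1 - z)^2) <= v], so the error keeps the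
    factor [v] and can later be summed against q. *)
Lemma bernoulli_cf_taylor z s : 0 <= z <= 1 -> `|s| <= 1 ->
  Normc.normc (bernoulli_cf z s - (expR (- (z * (1 - z) * s ^+ 2 / 2)))%:C) <=
  z * (1 - z) * `|s| ^+ 3 / 2.
Proof.
move=> /andP[z0 z1] s1; set v := z * (1 - z).
have v0 : 0 <= v by rewrite mulr_ge0// subr_ge0.
have v4 : v <= 1 / 4.
  by rewrite /v; have := sqr_ge0 (z - 1 / 2); rewrite sqrrB; lra.
have zs : `|- (z * s)| <= 1.
  by rewrite normrN normrM ger0_norm// mulr_ile1.
have z's : `|(1 - z) * s| <= 1.
  by rewrite normrM ger0_norm ?subr_ge0// mulr_ile1// ?subr_ge0//; lra.
have H1 := expi_taylor zs; have H2 := expi_taylor z's.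
set r1 := expi _ - _ in H1; set r2 := expi _ - _ in H2.
have -> : bernoulli_cf z s - (expR (- (v * s ^+ 2 / 2)))%:C =
  (1 - z)%:C * r1 + z%:C * r2 +
  (1 - v * s ^+ 2 / 2 - expR (- (v * s ^+ 2 / 2)))%:C.
  by apply/eqP; rewrite eq_complex /= /v; apply/andP; split; apply/eqP; field.
apply: le_trans (le_normcD _ _) _; rewrite normc_real distrC.
have y0 : 0 <= v * s ^+ 2 / 2 by rewrite divr_ge0// mulr_ge0// sqr_ge0.
have := expRN_taylor_dist y0; set e := `|_| => He.
have s3 : 0 <= `|s| ^+ 3 by rewrite exprn_ge0.
have He2 : (v * s ^+ 2 / 2) ^+ 2 / 2 <= v * `|s| ^+ 3 / 32.
  have : s ^+ 4 <= `|s| ^+ 3.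
    rewrite -(@ger0_norm _ (s ^+ 4)) ?exprn_even_ge0// normrX exprSr.
    by rewrite ler_piMr// exprn_ge0.
  have s4 : 0 <= s ^+ 4 by rewrite exprn_even_ge0.
  have -> : (v * s ^+ 2 / 2) ^+ 2 / 2 = v * (v * s ^+ 4) / 8 by field.
  move=> H; have : v * s ^+ 4 <= 1 / 4 * `|s| ^+ 3 by apply: ler_pM.
  move=> /(ler_wpM2l v0); lra.
apply: le_trans (lerD (le_normcD _ _) (le_trans He He2)) _.
rewrite !Normc.normcM !normc_real (ger0_norm z0) ger0_norm ?subr_ge0//.
move: H1 H2; rewrite normrN !normrM (ger0_norm z0) (@ger0_norm _ (1 - z)) ?subr_ge0//.
rewrite !exprMn.
have z0' : 0 <= 1 - z by rewrite subr_ge0.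
move=> /(ler_wpM2l z0') H1 /(ler_wpM2l z0) H2.
have zz : z ^+ 2 + (1 - z) ^+ 2 <= 1.
  by have := v0; rewrite /v sqrrB; lra.
have : v * `|s| ^+ 3 * (z ^+ 2 + (1 - z) ^+ 2) <= v * `|s| ^+ 3.
  by rewrite ler_piMr// mulr_ge0.
have -> : v * `|s| ^+ 3 * (z ^+ 2 + (1 - z) ^+ 2) =
  (1 - z) * (z ^+ 3 * `|s| ^+ 3) + z * ((1 - z) ^+ 3 * `|s| ^+ 3).
  by rewrite /v; ring.
have := mulr_ge0 v0 s3; lra.
Qed.

(** Factors are exchanged one at a time. The common majorant [E] survives in every exchange, so the
    relative errors [D] simply add. *)
Lemma normc_prodB (I : Type) (r : seq I) (u w : I -> C) (E D : I -> R) :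
  (forall i, 0 < E i) -> (forall i, Normc.normc (u i) <= E i) ->
  (forall i, Normc.normc (w i) <= E i) ->
  (forall i, Normc.normc (u i - w i) <= D i * E i) ->
  Normc.normc (\prod_(i <- r) u i - \prod_(i <- r) w i) <=
  (\sum_(i <- r) D i) * \prod_(i <- r) E i.
Proof.
move=> E0 uE wE uwD; elim: r => [|i r IH].
  by rewrite !big_nil subrr mul0r Normc.normc0.
rewrite !big_cons; set U := \prod_(j <- r) u j; set W := \prod_(j <- r) w j.
have -> : u i * U - w i * W = (u i - w i) * U + w i * (U - W) by ring.
have UE : Normc.normc U <= \prod_(j <- r) E j.
  rewrite normc_prod; apply: ler_prod => j _.
  by rewrite normc_ge0 uE.
apply: le_trans (le_normcD _ _) _; rewrite !Normc.normcM mulrDl.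
apply: lerD.
  by rewrite mulrA; apply: ler_pM => //; exact: normc_ge0.
by rewrite mulrCA; apply: ler_pM => //; exact: normc_ge0.
Qed.

(** The fourth-order bound on the cosine gives one majorant for both the characteristic function and
    [exp (- q)]; the quartic sum is its price. The first estimate serves where all [s j] are small,
    the second elsewhere. *)
Lemma bernoulli_cf_prod (n : nat) (z s : 'I_n -> R) :
  (forall j, 0 <= z j <= 1) -> (forall j, `|s j| <= 1 / 4) ->
  let v j := z j * (1 - z j) in
  let q := 2^-1 * \sum_j v j * s j ^+ 2 in
  let D := Normc.normc (\prod_j bernoulli_cf (z j) (s j) - (expR (- q))%:C) in
  let T := expR (- q + \sum_j v j * s j ^+ 4 / 24) in
  D <= (\sum_j v j * `|s j| ^+ 3) * T /\ D <= 2 * T.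
Proof.
move=> z01 s4 v q D T.
have v0 j : 0 <= v j.
  by have /andP[? ?] := z01 j; rewrite mulr_ge0// subr_ge0.
have v4 j : v j <= 1 / 4.
  by rewrite /v; have := sqr_ge0 (z j - 1 / 2); rewrite sqrrB; lra.
pose E j := expR (- (v j * s j ^+ 2 / 2) + v j * s j ^+ 4 / 24).
pose w j := (expR (- (v j * s j ^+ 2 / 2)))%:C.
have wE : (expR (- q))%:C = \prod_j w j.
  rewrite -(rmorph_prod (real_complex R)) -expR_sum; congr (expR _)%:C.
  rewrite /q mulr_sumr -sumrN; apply: eq_bigr => j _.
  by rewrite [2^-1 * _]mulrC.
have TE : T = \prod_j E j.
  rewrite /T /E -expR_sum; congr expR; rewrite big_split sumrN; congr (- _ + _).
  by rewrite /q mulr_sumr; apply: eq_bigr => j _; rewrite [2^-1 * _]mulrC.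
have uE j : Normc.normc (bernoulli_cf (z j) (s j)) <= E j.
  apply: le_trans (normc_bernoulli_cf _ (z01 j)) _; rewrite ler_expR -/(v j).
  by have := ler_wpM2l (v0 j) (cos_le_taylor4 (s j)); lra.
have wEj j : Normc.normc (w j) <= E j.
  rewrite normc_real ger0_norm ?expR_ge0// ler_expR lerDl.
  by rewrite divr_ge0// mulr_ge0// exprn_even_ge0.
have E0 j : 0 < E j by exact: expR_gt0.
split; rewrite /D wE TE.
  apply: normc_prodB => // j.
  have s1 : `|s j| <= 1 by have := s4 j; lra.
  apply: le_trans (bernoulli_cf_taylor (z01 j) s1) _; rewrite -/(v j).
  (* What remains is [1 / 2 <= E j], true since [v j * s j ^+ 2 / 2 <= 1 / 8]. *)
  apply: ler_wpM2l; first by rewrite mulr_ge0 ?exprn_ge0.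
  apply: le_trans (expR_ge1Dx _).
  have s2 : s j ^+ 2 <= 1.
    by rewrite -(real_normK (num_real _)) exprn_ile1.
  have : v j * s j ^+ 2 <= 1 / 4 * 1 by apply: ler_pM => //; exact: sqr_ge0.
  have : 0 <= v j * s j ^+ 4 by rewrite mulr_ge0// exprn_even_ge0.
  lra.
apply: le_trans (le_normcD _ _) _; rewrite normcN !normc_prod.
rewrite mulr_natl mulr2n.
by apply: lerD; apply: ler_prod => j _; rewrite normc_ge0; [exact: uE|exact: wEj].
Qed.

End ComplexFactors.

(** * Quadratic forms and Schur complements *)

Section Quadratic.
Context {R : realType}.
Implicit Types (a x : R) (d : nat).

Lemma dotpE d (u t : 'cV[R]_d) : dotp u t = (u^T *m t) 0 0.
Proof. by rewrite mxE; apply: eq_bigr => i _; rewrite mxE. Qed.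

Lemma dotpC d (u t : 'cV[R]_d) : dotp u t = dotp t u.
Proof. by apply: eq_bigr => i _; rewrite mulrC. Qed.

Lemma dotpDl d (u v t : 'cV[R]_d) : dotp (u + v) t = dotp u t + dotp v t.
Proof. by rewrite -big_split/=; apply: eq_bigr => i _; rewrite mxE mulrDl. Qed.

Lemma dotpZl d x (u t : 'cV[R]_d) : dotp (x *: u) t = x * dotp u t.
Proof. by rewrite mulr_sumr; apply: eq_bigr => i _; rewrite mxE mulrA. Qed.

Lemma dotpNl d (u t : 'cV[R]_d) : dotp (- u) t = - dotp u t.
Proof. by rewrite -scaleN1r dotpZl mulN1r. Qed.

Lemma dotp0l d (t : 'cV[R]_d) : dotp 0 t = 0.
Proof. by rewrite /dotp big1// => i _; rewrite mxE mul0r. Qed.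

Definition quadf d (Q : 'M[R]_d) (t : 'cV[R]_d) : R := (t^T *m Q *m t) 0 0.

Definition posdef d (Q : 'M[R]_d) :=
  Q^T = Q /\ forall t, t != 0 -> 0 < quadf Q t.

Lemma quadfZ d x (Q : 'M[R]_d) t : quadf (x *: Q) t = x * quadf Q t.
Proof. by rewrite /quadf -scalemxAr -scalemxAl mxE. Qed.

Lemma posdefZ d x (Q : 'M[R]_d) : 0 < x -> posdef Q -> posdef (x *: Q).
Proof.
move=> x0 [Qs Qp]; split; first by rewrite linearZ/= Qs.
by move=> t t0; rewrite quadfZ mulr_gt0// Qp.
Qed.

Section Schur.
Variables (d : nat) (Q : 'M[R]_(1 + d)).

Definition pivot : R := Q 0 0.
Definition pivot_col : 'cV[R]_d := dlsubmx Q.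
Definition schur : 'M[R]_d :=
  drsubmx Q - pivot^-1 *: (pivot_col *m pivot_col^T).

Hypothesis Qs : Q^T = Q.

Lemma pivot_block :
  Q = block_mx pivot%:M pivot_col^T pivot_col (drsubmx Q).
Proof.
rewrite -{1}(submxK Q); congr block_mx.
  by rewrite [ulsubmx Q]mx11_scalar !mxE/= !lshift0.
by rewrite /pivot_col trmx_dlsub Qs.
Qed.

Hypothesis pivot0 : pivot != 0.

Lemma quadf_schur x (t : 'cV[R]_d) :
  quadf Q (col_mx x%:M t) =
  pivot * (x + dotp pivot_col t / pivot) ^+ 2 + quadf schur t.
Proof.
set a := pivot; set v := pivot_col.
have mxD (A B : 'M[R]_1) : (A + B) 0 0 = A 0 0 + B 0 0 by rewrite mxE.
have mxB (A B : 'M[R]_1) : (A - B) 0 0 = A 0 0 - B 0 0 by rewrite 2!mxE.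
have mxZ (c : R) (A : 'M[R]_1) : (c *: A) 0 0 = c * A 0 0 by rewrite mxE.
have mxM (A B : 'M[R]_1) : (A *m B) 0 0 = A 0 0 * B 0 0.
  by rewrite mxE big_ord1.
have quadS : quadf schur t = quadf (drsubmx Q) t - a^-1 * dotp v t ^+ 2.
  rewrite /quadf /schur mulmxBr mulmxBl mxB -/a -/v; congr (_ - _).
  rewrite -scalemxAr -scalemxAl mxZ; congr (_ * _).
  by rewrite mulmxA -(mulmxA (t^T *m v)) mxM -!dotpE [dotp t v]dotpC expr2.
rewrite quadS /quadf {1}pivot_block tr_col_mx tr_scalar_mx mul_row_block.
rewrite mul_row_col !mulmxDl -/a -/v !mul_scalar_mx !mul_mx_scalar.
rewrite -scalemxAl !mxD !mxZ -!dotpE [dotp t v]dotpC.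
by rewrite !mxE/= !mulr1n; field.
Qed.

Lemma det_schur : \det Q = pivot * \det schur.
Proof.
set a := pivot; set v := pivot_col.
(* One step of block elimination; the left factor is unitriangular. *)
have E : block_mx 1%:M 0 (- (a^-1 *: v)) 1%:M *m Q =
    block_mx a%:M v^T 0 schur.
  rewrite {1}pivot_block mulmx_block !mul1mx !mul0mx !addr0 -/a -/v.
  congr block_mx.
    by rewrite mul_mx_scalar scalerN scalerA divff// scale1r addNr.
  by rewrite mulNmx -scalemxAl addrC.
have := congr1 determinant E.
by rewrite det_mulmx det_lblock det_ublock !det1 !mul1r det_scalar1.
Qed.

Lemma schur_sym : schur^T = schur.
Proof.
rewrite /schur linearB linearZ/= trmx_mul trmxK.
by rewrite trmx_drsub Qs.
Qed.

End Schur.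

Lemma posdef_pivot d (Q : 'M[R]_(1 + d)) : posdef Q -> 0 < pivot Q.
Proof.
move=> [Qs Qp]; have := Qp (delta_mx 0 0).
have -> : quadf Q (delta_mx 0 0) = pivot Q.
  rewrite /quadf trmx_delta -rowE -colE !mxE//.
apply; apply/eqP => /matrixP /(_ 0 0); rewrite !mxE/= => /eqP.
by rewrite oner_eq0.
Qed.

Lemma posdef_schur d (Q : 'M[R]_(1 + d)) : posdef Q -> posdef (schur Q).
Proof.
move=> Qpd; have a0 := posdef_pivot Qpd; have [Qs Qp] := Qpd.
split; first exact: schur_sym.
move=> t t0.
(* This first coordinate makes the square in [quadf_schur] vanish. *)
have := Qp (col_mx (- (dotp (pivot_col Q) t / pivot Q))%:M t).
rewrite quadf_schur ?gt_eqF// addNr expr0n mulr0 add0r; apply.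
apply: contra t0 => /eqP H; apply/eqP; rewrite -(col_mxKd (- (dotp (pivot_col Q) t / pivot Q))%:M t) H.
by apply/matrixP => i j; rewrite !mxE.
Qed.

Lemma posdef_det d (Q : 'M[R]_d) : posdef Q -> 0 < \det Q.
Proof.
elim: d Q => [|d IH] Q Qp; first by rewrite det_mx00.
have a0 := posdef_pivot Qp.
rewrite (@det_schur d Q) ?gt_eqF//; last by case: Qp.
by rewrite mulr_gt0// IH//; exact: posdef_schur.
Qed.

(* the integral of [expR (- quadf Q t / 2)] over R^d *)
Definition gauss_mass d (Q : 'M[R]_d) : R :=
  Num.sqrt (2 * pi) ^+ d / Num.sqrt (\det Q).

Lemma gauss_mass0 (Q : 'M[R]_0) : gauss_mass Q = 1.
Proof. by rewrite /gauss_mass det_mx00 sqrtr1 expr0 divr1. Qed.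

Lemma gauss_massS d (Q : 'M[R]_(1 + d)) : posdef Q ->
  gauss_mass Q = Num.sqrt (2 * pi / pivot Q) * gauss_mass (schur Q).
Proof.
move=> Qp; have a0 := posdef_pivot Qp.
rewrite /gauss_mass det_schur ?gt_eqF//; last by case: Qp.
rewrite (sqrtrM _ (ltW a0)) (@sqrtrM _ (2 * pi)) ?mulr_ge0 ?pi_ge0//.
by rewrite sqrtrV ?ltW// exprS invfM mulrACA.
Qed.

Lemma gauss_mass_gt0 d (Q : 'M[R]_d) : posdef Q -> 0 < gauss_mass Q.
Proof.
move=> Qp; rewrite divr_gt0// ?exprn_gt0// sqrtr_gt0 ?posdef_det//.
by rewrite mulr_gt0// pi_gt0.
Qed.

End Quadratic.

(** * Gaussian sums over grids *)

Section Grid.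
Context {R : realType}.
Implicit Types (a x h eta : R) (d K : nat).

Definition grid d h K (k : {ffun 'I_d -> 'I_(K.*2.+1)}) : 'cV[R]_d :=
  \col_i (h * ((k i)%:R - K%:R)).

Definition gridsum d h K (f : 'cV[R]_d -> R) : R :=
  h ^+ d * \sum_k f (@grid d h K k).

Lemma gridsum0 h K f : @gridsum 0 h K f = f 0.
Proof.
rewrite /gridsum expr0 mul1r.
have E (k : {ffun 'I_0 -> 'I_(K.*2.+1)}) : f (grid h k) = f 0.
  by congr f; apply/matrixP => -[].
rewrite (eq_bigr _ (fun k _ => E k)) sumr_const.
by rewrite card_ffun !card_ord expn0.
Qed.

Definition ffun_cons (T : finType) d (p : T * {ffun 'I_d -> T}) :
  {ffun 'I_d.+1 -> T} := [ffun i => oapp p.2 p.1 (unlift ord0 i)].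

Lemma ffun_cons_bij (T : finType) d : bijective (@ffun_cons T d).
Proof.
exists (fun f : {ffun 'I_d.+1 -> T} => (f ord0, [ffun i => f (lift ord0 i)])).
  move=> [x k]; congr pair; first by rewrite ffunE unlift_none.
  by apply/ffunP => i; rewrite !ffunE liftK.
move=> f; apply/ffunP => i; rewrite ffunE.
by case: unliftP => [j|] ->//=; rewrite ffunE.
Qed.

Lemma grid_cons d h K (x : 'I_(K.*2.+1)) (k : {ffun 'I_d -> 'I_(K.*2.+1)}) :
  @grid d.+1 h K (ffun_cons (x, k)) =
  col_mx (h * (x%:R - K%:R))%:M (grid h k) :> 'cV[R]_(1 + d).
Proof.
apply/matrixP => i j; rewrite (ord1 j) !mxE ffunE.
case: splitP => i' iE.
  have -> : i = ord0 by apply/val_inj; rewrite /= iE (ord1 i').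
  by rewrite unlift_none/= !mxE (ord1 i') mulr1n.
have -> : i = lift ord0 i' by apply/val_inj; rewrite /= iE.
by rewrite liftK/= mxE.
Qed.

Lemma gridsumS d h K (f : 'cV[R]_(1 + d) -> R) :
  @gridsum d.+1 h K f =
  gridsum h K (fun t => h * \sum_(x < K.*2.+1)
     f (col_mx (h * (x%:R - K%:R))%:M t)).
Proof.
rewrite /gridsum exprSr -mulrA; congr (_ * _); rewrite -mulr_sumr; congr (_ * _).
rewrite (reindex _ (onW_bij _ (@ffun_cons_bij _ d))) exchange_big pair_bigA/=.
by apply: eq_bigr => -[x k] _; rewrite grid_cons.
Qed.

Lemma gridsum_le d h K (f g : 'cV[R]_d -> R) : 0 <= h ->
  (forall k, f (@grid d h K k) <= g (@grid d h K k)) ->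
  gridsum h K f <= gridsum h K g.
Proof.
by move=> h0 fg; rewrite ler_wpM2l ?exprn_ge0//; apply: ler_sum => k _.
Qed.

Lemma eq_gridsum d h K (f g : 'cV[R]_d -> R) : f =1 g ->
  gridsum h K f = gridsum h K g.
Proof. by move=> fg; congr (_ * _); apply: eq_bigr => k _. Qed.

Lemma gridsumZ d h K a (f : 'cV[R]_d -> R) :
  gridsum h K (fun t => a * f t) = a * gridsum h K f.
Proof. by rewrite /gridsum -mulr_sumr mulrCA. Qed.

Lemma gridsumD d h K (f g : 'cV[R]_d -> R) :
  gridsum h K (fun t => f t + g t) = gridsum h K f + gridsum h K g.
Proof. by rewrite /gridsum big_split mulrDr. Qed.

Lemma gridsum_sum d h K (I : Type) (r : seq I) (f : I -> 'cV[R]_d -> R) :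
  gridsum h K (fun t => \sum_(i <- r) f i t) = \sum_(i <- r) gridsum h K (f i).
Proof. by rewrite /gridsum exchange_big mulr_sumr. Qed.

(** Grids of equal spacing are nested, so only the support of [f] matters. [K1] may exceed [K2]:
    this is how a sum over a huge grid is brought back to the cube. *)
Lemma gridsum_embed d h K1 K2 (f : 'cV[R]_d -> R) : 0 < h ->
  (forall t, 0 <= f t) ->
  (forall k, f (@grid d h K1 k) != 0 ->
     forall i, `|@grid d h K1 k i 0| <= h * K2%:R) ->
  gridsum h K1 f <= gridsum h K2 f.
Proof.
move=> h0 f0 fK; apply: ler_wpM2l; first by rewrite exprn_ge0 ?ltW.
pose P := [set k : {ffun 'I_d -> 'I_(K1.*2.+1)} | f (grid h k) != 0]%SET.
(* Recentres the indices; on [P] the truncated subtraction and [inord] lose nothing. *)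
pose e (k : {ffun 'I_d -> 'I_(K1.*2.+1)}) : {ffun 'I_d -> 'I_(K2.*2.+1)} :=
  [ffun i => inord (k i + K2 - K1)].
have eE k : k \in P -> grid h (e k) = grid h k.
  rewrite inE => /fK kK; apply/matrixP => i j; rewrite !mxE ffunE.
  have := kK i; rewrite mxE normrM (gtr0_norm h0) ler_pM2l// ler_norml.

  move=> /andP[k1 k2].
  have {}k1 : (K1 <= k i + K2)%N by rewrite -(ler_nat R) natrD; lra.
  have {}k2 : (k i <= K2 + K1)%N by rewrite -(ler_nat R) natrD; lra.
  have shift_lt (m a b : nat) :
    (a <= m + b)%N -> (m <= b + a)%N -> (m + b - a < b.*2.+1)%N by lia.
  rewrite inordK; last exact: shift_lt.
  by rewrite natrB// natrD; congr (_ * _); ring.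
rewrite (bigID (mem P))/= [X in _ + X]big1 ?addr0; last first.
  by move=> k; rewrite inE negbK => /eqP.
rewrite (eq_bigr (fun k => f (grid h (e k)))); last by move=> k /eE ->.
rewrite -(big_imset (fun k => f (grid h k)))/=; last first.
  move=> k k' kP k'P ek; have : grid h k = grid h k'.
    by rewrite -(eE _ kP) -(eE _ k'P) ek.
  move=> /matrixP H; apply/ffunP => i; apply/val_inj/eqP.
  have := H i 0; rewrite !mxE => /(mulfI (lt0r_neq0 h0)) /addIr /eqP.
  by rewrite eqr_nat.
rewrite [leRHS](bigID (mem (e @: P)%SET))/= lerDl.
by apply: sumr_ge0 => k _.
Qed.

End Grid.

(** * Multidimensional Gaussian sums compared with the Gaussian mass *)

Section GaussGrid.
Context {R : realType}.
Implicit Types (a x h eta : R) (d K : nat).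

Lemma dotp_col_mx d x y (u t : 'cV[R]_d) :
  dotp (col_mx x%:M u : 'cV_(1 + d)) (col_mx y%:M t) = x * y + dotp u t.
Proof.
rewrite !dotpE tr_col_mx mul_row_col mxE tr_scalar_mx -scalar_mxM.
by rewrite [X in X + _]mxE mulr1n.
Qed.

Lemma gauss_complete_square d (Q : 'M[R]_(1 + d)) u1 (u t : 'cV[R]_d) x :
  posdef Q ->
  dotp (col_mx u1%:M u : 'cV_(1 + d)) (col_mx x%:M t)
    - quadf Q (col_mx x%:M t) / 2 =
  u1 ^+ 2 / (2 * pivot Q)
  + (dotp (u - (u1 / pivot Q) *: pivot_col Q) t - quadf (schur Q) t / 2)
  - pivot Q / 2 * (x + (dotp (pivot_col Q) t - u1) / pivot Q) ^+ 2.
Proof.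
move=> Qp; have a0 := posdef_pivot Qp; have [Qs _] := Qp.
rewrite dotp_col_mx quadf_schur ?gt_eqF// dotpDl dotpNl dotpZl.
by field; rewrite gt_eqF.
Qed.

(** An upper bound [C] of the exponent, rather than its exact maximum, passes through the induction:
    summing out the first coordinate produces [exp (u1^2 / (2 a))], and [C - u1^2 / (2 a)] bounds
    the remaining exponent. The threshold [h0] is uniform in [K], [u] and [C]. *)
Lemma gridsum_gauss_le d (Q : 'M[R]_d) eta : posdef Q -> 0 < eta ->
  exists2 h0, 0 < h0 & forall h K (u : 'cV[R]_d) C, 0 < h -> h <= h0 ->
    (forall t, dotp u t - quadf Q t / 2 <= C) ->
    gridsum h K (fun t => expR (dotp u t - quadf Q t / 2)) <=
    expR C * (gauss_mass Q + eta).
Proof.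
elim: d Q eta => [|d IH] Q eta Qp eta0.
  exists 1 => // h K u C _ _ uC; rewrite gridsum0 gauss_mass0.
  apply: (@le_trans _ _ (expR C)); first by rewrite ler_expR.
  by rewrite ler_peMr ?expR_ge0//; lra.
have a0 := posdef_pivot Qp; have Sp := posdef_schur Qp.
set A := Num.sqrt (2 * pi / @pivot _ d Q).
have A0 : 0 <= A by exact: sqrtr_ge0.
have [B BE] : {B | B = gauss_mass (schur Q)} by eexists.
have B0 : 0 < B by rewrite BE gauss_mass_gt0.
(* For [2 h <= 1], [(A + 2 h) (B + eta1) - A B <= (A + 1) eta1 + 2 h B]; [eta1] and the last bound
   on [h] make each summand at most [eta / 2]. *)
pose eta1 := eta / (2 * (A + 1)).
have eta10 : 0 < eta1 by rewrite divr_gt0//; lra.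
have [h1 h10 H1] := IH _ _ Sp eta10.
exists (Num.min h1 (Num.min (1 / 2) (eta / (4 * (B + 1))))) => [|h K u C h0].
  by rewrite !lt_min h10 !divr_gt0//; lra.
rewrite !le_min => /and3P[hh1 h2 hB] uC.
pose u1 := u 0 0; pose u' : 'cV[R]_d := dsubmx (u : 'cV_(1 + d)).
have uE : u = col_mx u1%:M u' :> 'cV_(1 + d).
  rewrite -[LHS](@vsubmxK _ 1 d 1); congr col_mx.
  by rewrite [LHS]mx11_scalar !mxE lshift0.
pose v := @pivot_col _ d Q; pose a := @pivot _ d Q.
pose u2 := u' - (u1 / a) *: v.
(* The hypothesis is used at the first coordinate that annihilates the square. *)
have uC' t : dotp u2 t - quadf (schur Q) t / 2 <= C - u1 ^+ 2 / (2 * a).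
  have := uC (col_mx (- ((dotp v t - u1) / a))%:M t).
  rewrite uE gauss_complete_square// -/v -/a -/u2 addNr expr0n mulr0 subr0.
  lra.
have {}H1 := H1 h K u2 _ h0 hh1 uC'.
rewrite gridsumS.
apply: (@le_trans _ _ (gridsum h K (fun t : 'cV[R]_d =>
  (expR (u1 ^+ 2 / (2 * a)) * (A + 2 * h)) *
  expR (dotp u2 t - quadf (schur Q) t / 2)))).
  apply: gridsum_le; first exact: ltW.
  move=> k; set t := grid h k.
  have sqE x : expR (dotp u (col_mx x%:M t) - quadf Q (col_mx x%:M t) / 2) =
    expR (u1 ^+ 2 / (2 * a)) * expR (dotp u2 t - quadf (schur Q) t / 2) *
    expR (- (a / 2 * (x + (dotp v t - u1) / a) ^+ 2)).
    by rewrite {1}uE gauss_complete_square// -!expRD.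
  under eq_bigr => x _ do rewrite sqE.
  rewrite -mulr_sumr mulrCA [leRHS]mulrAC ler_wpM2l//.
  exact: gauss_sum_le (ltW h0).
rewrite gridsumZ (gauss_massS Qp) -/A -BE.
have c0 : 0 <= expR (u1 ^+ 2 / (2 * a)) * (A + 2 * h).
  by rewrite mulr_ge0 ?expR_ge0//; lra.
apply: le_trans (ler_wpM2l c0 H1) _.
have -> : expR C = expR (u1 ^+ 2 / (2 * a)) * expR (C - u1 ^+ 2 / (2 * a)).
  by rewrite -expRD addrC subrK.
rewrite mulrACA ler_wpM2l ?mulr_ge0 ?expR_ge0//.
have E1 : (A + 1) * eta1 = eta / 2 by rewrite /eta1; field; lra.
have E2 : h * (B + 1) <= eta / 4.
  have : 0 < B + 1 by lra.
  move=> B1; move: hB; rewrite -(ler_pM2r B1) => /le_trans; apply.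
  by rewrite le_eqVlt; apply/orP; left; apply/eqP; field; lra.
have : 2 * h * eta1 <= eta1 by apply: ler_piMl; lra.
rewrite -BE; have := mulr_ge0 (ltW h0) (ltW B0); lra.
Qed.

(** The remaining coordinates are confined to a fixed grid of extent [K1], on which the shift of the
    inner sum is bounded; the first coordinate may then range as far as that shift requires. Hence
    [K0] depends on [h]. *)
Lemma gridsum_gauss_ge d (Q : 'M[R]_d) eta : posdef Q -> 0 < eta ->
  exists2 h0, 0 < h0 & forall h, 0 < h -> h <= h0 ->
    exists K0, forall K, (K0 <= K)%N ->
    gauss_mass Q - eta <= gridsum h K (fun t => expR (- (quadf Q t / 2))).
Proof.
elim: d Q eta => [|d IH] Q eta Qp eta0.
  exists 1 => // h _ _; exists 0%N => K _; rewrite gridsum0 gauss_mass0.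
  by rewrite /quadf mulmx0 mxE mul0r oppr0 expR0; lra.
have a0 := posdef_pivot Qp; have Sp := posdef_schur Qp.
set a := @pivot _ d Q in a0; set v := @pivot_col _ d Q.
set A := Num.sqrt (2 * pi / a).
have A0 : 0 < A by rewrite sqrtr_gt0 divr_gt0// mulr_gt0// pi_gt0.
have [B BE] : {B | B = gauss_mass (schur Q)} by eexists.
have B0 : 0 < B by rewrite BE gauss_mass_gt0.
(* As [2 h <= eta2], the loss in [(A - 2 h - eta2) (B - eta1)] is at most
   [A eta1 + 2 B eta2 <= eta]; the bound [A / 4] keeps the first factor nonnegative. *)
pose eta1 := Num.min (eta / (2 * A)) (B / 2).
have eta10 : 0 < eta1 by rewrite lt_min !divr_gt0 ?mulr_gt0.
pose eta2 := Num.min (eta / (4 * B)) (A / 4).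
have eta20 : 0 < eta2 by rewrite lt_min !divr_gt0 ?mulr_gt0.
have [h1 h10 H1] := IH _ _ Sp eta10.
have [X X0 HX] := gauss_sum_ge a0 eta20.
exists (Num.min h1 (eta2 / 2)) => [|h h0].
  by rewrite !lt_min h10 !divr_gt0//; lra.
rewrite !le_min => /andP[hh1 h2].
have [K1 HK1] := H1 h h0 hh1.
(* A sum over the finite grid serves as a bound for all the shifts. *)
pose W := \sum_(k : {ffun 'I_d -> 'I_(K1.*2.+1)}) `|dotp v (grid h k) / a|.
have W0 : 0 <= W by exact: sumr_ge0.
have XW0 : 0 <= (X + W) / h by apply: divr_ge0; [exact: addr_ge0|exact: ltW].
exists (maxn K1 (Num.bound ((X + W) / h))) => K.
rewrite geq_max => /andP[K1K hK].
have {}hK : X + W <= h * K%:R.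
  rewrite mulrC -ler_pdivrMr//; apply: ltW; apply: lt_le_trans (archi_boundP XW0) _.
  by rewrite ler_nat.
rewrite gridsumS (gauss_massS Qp) -/a -/A -BE.
pose inner (t : 'cV[R]_d) : R := h * \sum_(x < K.*2.+1)
  expR (- (a / 2 * (h * (x%:R - K%:R) + dotp v t / a) ^+ 2)).
have inner0 t : 0 <= inner t.
  by apply: mulr_ge0; [exact: ltW|apply: sumr_ge0 => x _; exact: expR_ge0].
rewrite (@eq_gridsum _ _ _ _ _
  (fun t : 'cV[R]_d => expR (- (quadf (schur Q) t / 2)) * inner t)); last first.
  move=> t /=; rewrite /inner mulrCA; congr (_ * _); rewrite mulr_sumr.
  apply: eq_bigr => x _; rewrite -expRD; congr expR.
  have [Qs _] := Qp.
  by rewrite quadf_schur ?gt_eqF// -/a -/v; ring.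
have emb : gridsum h K1 (fun t : 'cV[R]_d =>
    expR (- (quadf (schur Q) t / 2)) * inner t) <=
  gridsum h K (fun t => expR (- (quadf (schur Q) t / 2)) * inner t).
  apply: gridsum_embed => //.
    by move=> t; rewrite mulr_ge0 ?expR_ge0.
  move=> k _ i; rewrite mxE normrM (gtr0_norm h0) ler_pM2l//.
  apply: (@le_trans _ _ K1%:R); last by rewrite ler_nat.
  have : (k i <= K1.*2)%N by rewrite -ltnS.
  move: (nat_of_ord (k i)) => m; rewrite -(ler_nat R) -addnn natrD => m2.
  by have := ler0n R m; rewrite ler_norml; lra.
apply: le_trans emb.
apply: (@le_trans _ _ ((A - 2 * h - eta2) *
   gridsum h K1 (fun t => expR (- (quadf (schur Q) t / 2))))); last first.
  rewrite -gridsumZ; apply: gridsum_le; first exact: ltW.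
  move=> k; rewrite mulrC ler_wpM2l ?expR_ge0//.
  apply: HX; first exact: ltW.
  apply: le_trans hK; rewrite lerD2l /W (bigD1 k)//= lerDl.
  exact: sumr_ge0.
have := HK1 K1 (leqnn _); rewrite -BE.
have e1A : eta1 <= eta / (2 * A) by rewrite /eta1 ge_min lexx.
have e1B : eta1 <= B / 2 by rewrite /eta1 ge_min lexx orbT.
have e2B : eta2 <= eta / (4 * B) by rewrite /eta2 ge_min lexx.
have e2A : eta2 <= A / 4 by rewrite /eta2 ge_min lexx orbT.
have F1 : A * eta1 <= eta / 2.
  apply: le_trans (ler_wpM2l (ltW A0) e1A) _.
  by rewrite le_eqVlt; apply/orP; left; apply/eqP; field; lra.
have F2 : B * eta2 <= eta / 4.
  apply: le_trans (ler_wpM2l (ltW B0) e2B) _.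
  by rewrite le_eqVlt; apply/orP; left; apply/eqP; field; lra.
have c0 : 0 <= A - 2 * h - eta2 by lra.
move=> /(ler_wpM2l c0) H; apply: le_trans H.
have c1 : 2 * h + eta2 <= 2 * eta2 by lra.
have := ler_wpM2l (ltW B0) c1.
have : 0 <= (2 * h + eta2) * eta1 by apply: mulr_ge0; lra.
lra.
Qed.

End GaussGrid.

(** * Fourier inversion *)

Section FourierInversion.
Context {R : realType}.
Implicit Types (d n K : nat).

Lemma expi2pi_int (m : int) : expi (2 * pi * m%:~R) = 1 :> R[i].
Proof.
case: m => n; first exact: expi2pi_nat.
have := @expiD R (2 * pi * (Negz n)%:~R) (2 * pi * n.+1%:R).
by rewrite expi2pi_nat mulr1 => <-; rewrite NegzE -mulrDr mulrNz addNr mulr0 expi0.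
Qed.

Lemma expi_neq1 (x : R) : 0 < `|x| -> `|x| < 2 * pi -> expi x != 1.
Proof.
move=> x0 xpi; apply/eqP => /(congr1 (@complex.Re R)) /=; rewrite -cos_norm.
have -> : `|x| = (`|x| / 2) *+ 2 by rewrite -mulr_natr divfK.
rewrite cos_mulr2n cos2sin2 => H.
have : 0 < sin (`|x| / 2).
  by apply: sin_gt0_pi; rewrite divr_gt0//= ltr_pdivrMr// mulrC.
move=> /(exprn_gt0 2); move: H; rewrite mulr2n; lra.
Qed.

(** A geometric sum whose ratio is an N-th root of unity; [|m| < N] keeps its angle strictly within
    [2 pi], so the ratio is not 1 unless [m = 0]. *)
Lemma sum_expi_period (m : int) K : (`|m| < K.*2.+1)%N ->
  \sum_(y < K.*2.+1)
     expi (m%:~R * ((2 * pi / K.*2.+1%:R) * (y%:R - K%:R))) =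
  (if m == 0 then K.*2.+1%:R else 0) :> R[i].
Proof.
set N := K.*2.+1 => mN; set h := 2 * pi / N%:R.
have N0 : 0 < N%:R :> R by rewrite ltr0n.
case: eqP => [->|/eqP m0].
  rewrite (eq_bigr (fun _ => 1)); first by rewrite sumr_const card_ord.
  by move=> y _; rewrite mul0r expi0.
pose r := expi (m%:~R * h).
rewrite (eq_bigr (fun y : 'I_N => expi (- (m%:~R * h * K%:R)) * r ^+ y)); last first.
  move=> y _; rewrite /r -expiM_nat -expiD; congr expi; ring.
rewrite -mulr_sumr; apply/eqP; rewrite mulf_eq0; apply/orP; right.
have rN : r ^+ N = 1.
  rewrite /r -expiM_nat -(expi2pi_int m); congr expi.
  by rewrite /h; field; rewrite gt_eqF.
have := subrX1 r N; rewrite rN subrr => /esym/eqP.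
rewrite mulf_eq0 subr_eq0 => /orP[|//]; apply: contraTT => _.
have hE : `|m%:~R * h| = `|m|%N%:R * (2 * pi) / N%:R.
  rewrite normrM -mulrA; congr (_ * _).
    by rewrite -intr_norm -abszE.
  by rewrite ger0_norm// divr_ge0 ?mulr_ge0 ?pi_ge0// ltW.
have p0 : 0 < 2 * pi :> R by rewrite mulr_gt0// pi_gt0.
apply: expi_neq1; rewrite hE.
  by rewrite divr_gt0// mulr_gt0// ltr0n absz_gt0.
by rewrite ltr_pdivrMr// mulrC ltr_pM2l// ltr_nat.
Qed.

Lemma gridsum_expi d (m : 'cV[int]_d) K :
  (forall i, (`|m i 0%R| < K.*2.+1)%N) ->
  \sum_(k : {ffun 'I_d -> 'I_(K.*2.+1)})
     expi (dotp (toreal R m) (grid (2 * pi / K.*2.+1%:R) k)) =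
  (if m == 0 then K.*2.+1%:R ^+ d else 0) :> R[i].
Proof.
move=> mK; pose h : R := 2 * pi / K.*2.+1%:R.
rewrite (eq_bigr (fun k : {ffun 'I_d -> 'I_(K.*2.+1)} =>
  \prod_i expi ((m i 0)%:~R * (h * ((k i)%:R - K%:R))))); last first.
  by move=> k _; rewrite -expi_sum; congr expi; apply: eq_bigr => i _; rewrite !mxE.
rewrite -(bigA_distr_bigA (fun i (y : 'I_(K.*2.+1)) =>
  expi ((m i 0)%:~R * (h * (y%:R - K%:R))))).
rewrite (eq_bigr _ (fun i _ => sum_expi_period (mK i))).
case: eqP => [->|m0].
  rewrite (eq_bigr (fun _ => K.*2.+1%:R)).
    by rewrite prodr_const card_ord.
  by move=> i _; rewrite mxE eqxx.
have /existsP[i mi] : [exists i, m i 0 != 0].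
  rewrite -negb_forall; apply/negP => /forallP H; apply: m0.
  by apply/matrixP => i j; rewrite (ord1 j) mxE; exact/eqP.
by rewrite (bigD1 i)//= (negbTE mi) mul0r.
Qed.

Lemma toreal_inj p q : injective (@toreal R p q).
Proof.
by move=> A B /matrixP AB; apply/matrixP => i j; have := AB i j;
  rewrite !mxE => /intr_inj.
Qed.

Lemma toreal_mul p q r (A : 'M[int]_(p, q)) (B : 'M[int]_(q, r)) :
  toreal R (A *m B) = toreal R A *m toreal R B.
Proof. exact: map_mxM. Qed.

Lemma torealB p q (A B : 'M[int]_(p, q)) :
  toreal R (A - B) = toreal R A - toreal R B.
Proof. exact: map_mxB. Qed.

Definition bits n (x : {ffun 'I_n -> bool}) : 'cV[int]_n := \col_j (x j)%:R.

Definition bernoulli_pmf n (z : 'cV[R]_n) (x : {ffun 'I_n -> bool}) : R :=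
  \prod_j (if x j then z j 0 else 1 - z j 0).

Definition char_fun d n (A : 'M[int]_(d, n)) (z : 'cV[R]_n) (t : 'cV[R]_d) : R[i] :=
  \prod_j bernoulli_cf (z j 0) (dotp (col j (toreal R A)) t).

(** The right side is the expectation of [exp (i <A X - b, t>)]; [A z = b] turns the centring of
    each factor into the shift by [b]. *)
Lemma char_fun_expand d n (A : 'M[int]_(d, n)) (b : 'cV[int]_d) z t :
  toreal R A *m z = toreal R b ->
  char_fun A z t = \sum_(x : {ffun 'I_n -> bool})
    real_complex R (bernoulli_pmf z x) *
    expi (dotp (toreal R (A *m bits x - b)) t).
Proof.
move=> Az; pose s j := dotp (col j (toreal R A)) t.
pose F j (e : bool) : R[i] := real_complex R (if e then z j 0 else 1 - z j 0) *
  expi ((e%:R - z j 0) * s j).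
rewrite /char_fun (eq_bigr (fun j => \sum_e F j e)); last first.
  move=> j _; rewrite big_bool /F /bernoulli_cf addrC -/(s j).
  by congr (_ + _ * expi _); rewrite sub0r mulNr.
rewrite bigA_distr_bigA; apply: eq_bigr => x _; rewrite big_split/=.
rewrite -expi_sum -(rmorph_prod (real_complex R)); congr (_ * expi _).
rewrite torealB toreal_mul -Az -mulmxBr.
under [RHS]eq_bigr => i _ do rewrite mxE mulr_suml.
rewrite exchange_big/=; apply: eq_bigr => j _.
rewrite /s /dotp mulr_sumr; apply: eq_bigr => i _.
rewrite !mxE; case: (x j); rewrite /= ?rmorph0 ?rmorph1; ring.
Qed.

Lemma fourier_inversion d n (A : 'M[int]_(d, n)) (b : 'cV[int]_d) (z : 'cV[R]_n) :
  toreal R A *m z = toreal R b ->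
  exists K0, forall K, (K0 <= K)%N ->
  real_complex R ((2 * pi / K.*2.+1%:R) ^+ d) *
    \sum_(k : {ffun 'I_d -> 'I_(K.*2.+1)})
       char_fun A z (grid (2 * pi / K.*2.+1%:R) k) =
  real_complex R ((2 * pi) ^+ d *
    \sum_(x : {ffun 'I_n -> bool} | A *m bits x == b) bernoulli_pmf z x).
Proof.
move=> Az; pose m (x : {ffun 'I_n -> bool}) := A *m bits x - b.
(* The sum of all frequencies dominates each of them, so no nonzero one aliases to 0 on the grid. *)
exists (\sum_x \sum_i `|m x i 0%R|)%N => K hK.
have mK (x : {ffun 'I_n -> bool}) i : (`|m x i 0%R| < K.*2.+1)%N.
  have : (`|m x i 0%R| <= K)%N.
    apply: leq_trans hK; rewrite (bigD1 x)//= (bigD1 i)//=.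
    by rewrite -addnA leq_addr.
  by move=> H; rewrite ltnS (leq_trans H)// -addnn leq_addr.
under eq_bigr => k _ do rewrite (char_fun_expand _ Az).
rewrite exchange_big/=.
under eq_bigr => x _ do rewrite -mulr_sumr (gridsum_expi (mK x)).
rewrite (eq_bigr (fun x => if A *m bits x == b then
    real_complex R (K.*2.+1%:R ^+ d * bernoulli_pmf z x) else 0)); last first.
  move=> x _; rewrite subr_eq0; case: ifP => _; last by rewrite mulr0.
  by rewrite rmorphM rmorphXn rmorph_nat mulrC.
rewrite -big_mkcond/= -rmorph_sum -rmorphM; congr (real_complex R _).
by rewrite -mulr_sumr mulrA -exprMn divfK.
Qed.

End FourierInversion.

(** * The maximum entropy distribution *)

Section MaxEntropy.
Context {R : realType}.
Implicit Types (d n : nat).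

Lemma ln_le_subr1 (x : R) : 0 < x -> ln x <= x - 1.
Proof.
move=> x0; rewrite -ler_expR lnK ?posrE//.
by have := expR_ge1Dx (x - 1); lra.
Qed.

(** In disguise: the relative entropy of two Bernoulli laws is at most their chi-square divergence.
    It replaces a second-order expansion of the entropy. *)
Lemma entropy_term_ge (z x : R) : 0 < z < 1 -> 0 < x < 1 ->
  z * ln (1 / z) + (1 - z) * ln (1 / (1 - z))
    - (x - z) * (ln z - ln (1 - z)) - (x - z) ^+ 2 / (z * (1 - z)) <=
  x * ln (1 / x) + (1 - x) * ln (1 / (1 - x)) :> R.
Proof.
move=> /andP[z0 z1] /andP[x0 x1].
have z'0 : 0 < 1 - z by rewrite subr_gt0.
have x'0 : 0 < 1 - x by rewrite subr_gt0.
rewrite !div1r !lnV ?posrE//.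
have := ln_le_subr1 (divr_gt0 x0 z0); have := ln_le_subr1 (divr_gt0 x'0 z'0).
rewrite !ln_div ?posrE//.
move=> /(ler_wpM2l (ltW x'0)) H1 /(ler_wpM2l (ltW x0)) H2.
have E : (x - z) ^+ 2 / (z * (1 - z)) =
    (1 - x) * ((1 - x) / (1 - z) - 1) + x * (x / z - 1).
  by field; rewrite !gt_eqF.
rewrite E; lra.
Qed.

(** Since [alpha] keeps [z] away from the faces of the cube, both [z + c w] and [z - c w] are
    feasible for small [c]; maximality bounds the linear gain by a quadratic loss, which forces the
    slope [S] to vanish. *)
Lemma maximizer_orthogonal d n (A : 'M[int]_(d, n)) (b : 'cV[int]_d)
    (z w : 'cV[R]_n) alpha :
  polytope01 R A b z ->
  (forall x, polytope01 R A b x -> entropy x <= entropy z) ->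
  0 < alpha -> (forall j, alpha <= z j 0 * (1 - z j 0)) ->
  toreal R A *m w = 0 ->
  \sum_j w j 0 * (ln (z j 0) - ln (1 - z j 0)) = 0.
Proof.
move=> [Az z01] zmax alpha0 zalpha Aw; set S := \sum_j _.
have z0 j : alpha <= z j 0 /\ alpha <= 1 - z j 0.
  have /andP[a0 a1] := z01 j; have := zalpha j.
  have : 0 <= z j 0 * z j 0 by exact: mulr_ge0.
  have : 0 <= (1 - z j 0) * (1 - z j 0) by rewrite mulr_ge0// subr_ge0.
  by split; lra.
pose M := 1 + \sum_j `|w j 0|.
have wM j : `|w j 0| < M.
  rewrite /M (bigD1 j)//= addrCA ltrDl; have := sumr_ge0 (P := fun i => i != j)
    (index_enum 'I_n) (fun i _ => normr_ge0 (w i 0)); lra.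
have M0 : 0 < M by rewrite ltr_wpDr// sumr_ge0.
pose W := \sum_j w j 0 ^+ 2 / (z j 0 * (1 - z j 0)).
have v0 j : 0 < z j 0 * (1 - z j 0) := lt_le_trans alpha0 (zalpha j).
have W0 : 0 <= W.
  by apply: sumr_ge0 => j _; rewrite divr_ge0 ?sqr_ge0// ltW.
have key (c : R) : `|c| <= alpha / M -> - (c * S) <= c ^+ 2 * W.
  move=> cM.
  have cw j : `|c * w j 0| < alpha.
    have [->|c0] := eqVneq c 0; first by rewrite mul0r normr0.
    rewrite normrM; apply: (@lt_le_trans _ _ (`|c| * M)).
      by rewrite ltr_pM2l ?normr_gt0.
    by rewrite -ler_pdivlMr.
  have x01 j : 0 < z j 0 + c * w j 0 < 1.
    have [? ?] := z0 j; have := cw j; rewrite ltr_norml => /andP[? ?].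
    by apply/andP; split; lra.
  have /zmax : polytope01 R A b (z + c *: w).
    split; first by rewrite mulmxDr -scalemxAr Aw scaler0 addr0.
    by move=> j; rewrite !mxE; have /andP[? ?] := x01 j; apply/andP; split; lra.
  have : entropy z - c * S - c ^+ 2 * W <= entropy (z + c *: w).
    rewrite /entropy /S /W !mulr_sumr -!sumrB; apply: ler_sum => j _.
    rewrite !mxE; apply: le_trans (@entropy_term_ge (z j 0) _ _ (x01 j)).
      have -> : z j 0 + c * w j 0 - z j 0 = c * w j 0 by ring.
      by rewrite exprMn -!mulrA.
    by have [? ?] := z0 j; apply/andP; split; lra.
  lra.
apply/eqP/negP => /negP S0.
have nS0 : 0 < `|S| by rewrite normr_gt0.
(* The step tried is [- (c * S)]: the first bound keeps it feasible, the second gives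
   [c * W <= 1 / 2], against the conclusion [1 <= c * W]. *)
pose c := Num.min (alpha / M / `|S|) (1 / (2 * (W + 1))).
have c0 : 0 < c by rewrite lt_min !divr_gt0//; lra.
have /key : `|- (c * S)| <= alpha / M.
  rewrite normrN normrM (gtr0_norm c0) -ler_pdivlMr//.
  by rewrite /c ge_min lexx.
have -> : - (- (c * S) * S) = c * S ^+ 2 by ring.
have -> : (- (c * S)) ^+ 2 * W = (c * S ^+ 2) * (c * W) by ring.
rewrite -{1}[c * _]mulr1 ler_pM2l; last first.
  by rewrite mulr_gt0// lt0r sqrf_eq0 S0 sqr_ge0.
have : c * (W + 1) <= 1 / 2.
  have W1 : 0 < W + 1 by lra.
  rewrite -ler_pdivlMr//; have -> : 1 / 2 / (W + 1) = 1 / (2 * (W + 1)).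
    by field; rewrite gt_eqF.
  by rewrite /c ge_min lexx orbT.
have := mulr_ge0 (ltW c0) W0; lra.
Qed.

(** The logarithm of the mass at [x] exceeds [- h z] by the sum of
    [(x_j - z_j) (ln z_j - ln (1 - z_j))], which vanishes because [x - z] lies in the kernel of
    [A]. *)
Lemma bernoulli_pmf_max d n (A : 'M[int]_(d, n)) (b : 'cV[int]_d)
    (z : 'cV[R]_n) alpha (x : {ffun 'I_n -> bool}) :
  polytope01 R A b z ->
  (forall x, polytope01 R A b x -> entropy x <= entropy z) ->
  0 < alpha -> (forall j, alpha <= z j 0 * (1 - z j 0)) ->
  A *m bits x = b ->
  bernoulli_pmf z x = expR (- entropy z).
Proof.
move=> zP zmax alpha0 zalpha Ax; have [Az z01] := zP.
have z0 j : 0 < z j 0 /\ 0 < 1 - z j 0.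
  have /andP[a0 a1] := z01 j; have := zalpha j.
  have : 0 <= z j 0 * z j 0 by exact: mulr_ge0.
  have : 0 <= (1 - z j 0) * (1 - z j 0) by rewrite mulr_ge0// subr_ge0.
  by split; lra.
have : toreal R A *m (toreal R (bits x) - z) = 0.
  by rewrite mulmxBr -toreal_mul Ax Az subrr.
move=> /(maximizer_orthogonal zP zmax alpha0 zalpha) H.
have -> : - entropy z = - entropy z + 0 by rewrite addr0.
rewrite -H /entropy -sumrN -big_split/= expR_sum; apply: eq_bigr => j _.
have [? ?] := z0 j; rewrite !mxE !div1r !lnV ?posrE//.
case: (x j) => /=.
  by rewrite -[LHS]lnK ?posrE// rmorph1; congr expR; ring.
by rewrite -[LHS]lnK ?posrE// rmorph0; congr expR; ring.
Qed.

Lemma card_polytope01 d n (A : 'M[int]_(d, n)) (b : 'cV[int]_d) :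
  #|` fset_set (polytope01 R A b `&` vectors01 R n)| =
  #|[set x : {ffun 'I_n -> bool} | A *m bits x == b]%SET|.
Proof.
pose g (x : {ffun 'I_n -> bool}) : 'cV[R]_n := toreal R (bits x).
have g_inj : injective g.
  move=> x y /toreal_inj /matrixP xy; apply/ffunP => j; have := xy j 0.
  by rewrite !mxE; case: (x j); case: (y j).
have fin : finite_set (polytope01 R A b `&` vectors01 R n).
  exact: sub_finite_set (@subIsetr _ _ _) (finite_vectors01 R n).
have -> : fset_set (polytope01 R A b `&` vectors01 R n) =
  [fset g x | x in [set x : {ffun 'I_n -> bool} | A *m bits x == b]%SET]%fset.
  apply/fsetP => y; rewrite in_fset_set//; apply/idP/imfsetP.
    rewrite inE => -[[Ay _] y01].
    have gE : g [ffun j => y j 0 == 1] = y.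
      apply/matrixP => j j'; rewrite (ord1 j') !mxE ffunE.
      by case: (y01 j) => ->; rewrite ?eqxx ?(eq_sym 0) ?oner_eq0.
    exists [ffun j => y j 0 == 1]; last by rewrite gE.
    rewrite /= inE.
    by apply/eqP/(@toreal_inj R); rewrite toreal_mul -/(g _) gE.
  move=> [x /= xA ->].
  have {xA}Ax : A *m bits x = b by move: xA; rewrite inE => /eqP.
  rewrite inE; split.
    split; first by rewrite -toreal_mul Ax.
    by move=> j; rewrite !mxE; case: (x j); rewrite /= ?rmorph0 ?rmorph1 lexx ler01.
  by move=> j; rewrite !mxE; case: (x j); rewrite /= ?rmorph0 ?rmorph1; [right|left].
rewrite card_imfset// cardE; apply/perm_size/uniq_perm.
- exact: enum_finmem_uniq.
- exact: enum_uniq.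
- by move=> x; rewrite [RHS]mem_enum enum_finmemE.
Qed.

Lemma count_polytope01 d n (A : 'M[int]_(d, n)) (b : 'cV[int]_d)
    (z : 'cV[R]_n) alpha :
  polytope01 R A b z ->
  (forall x, polytope01 R A b x -> entropy x <= entropy z) ->
  0 < alpha -> (forall j, alpha <= z j 0 * (1 - z j 0)) ->
  #|` fset_set (polytope01 R A b `&` vectors01 R n)|%:R =
  expR (entropy z) *
    \sum_(x : {ffun 'I_n -> bool} | A *m bits x == b) bernoulli_pmf z x.
Proof.
move=> zP zmax alpha0 zalpha.
rewrite (eq_bigr (fun _ => expR (- entropy z))); last first.
  by move=> x /eqP Ax; rewrite (bernoulli_pmf_max zP zmax alpha0 zalpha Ax).
rewrite sumr_const mulrnAr -expRD addrN expR0.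
by rewrite card_polytope01 cardsE.
Qed.


End MaxEntropy.

(** * The two regions of the cube *)

Section FarRegion.
Context {R : realType}.
Implicit Types (d n : nat).

Lemma norm2_sqr m (x : 'cV[R]_m) : norm2 x ^+ 2 = dotp x x.
Proof.
by rewrite sqr_sqrtr// sumr_ge0// => i _; rewrite -expr2 sqr_ge0.
Qed.

Lemma dotp_toreal_mul d n (A : 'M[int]_(d, n)) (y : 'cV[int]_n) (t : 'cV[R]_d) :
  \sum_j (y j 0)%:~R * dotp (col j (toreal R A)) t = dotp (toreal R (A *m y)) t.
Proof.
rewrite /dotp toreal_mul.
under [RHS]eq_bigr => i _ do rewrite mxE mulr_suml.
rewrite exchange_big/=; apply: eq_bigr => j _.
by rewrite mulr_sumr; apply: eq_bigr => i _; rewrite !mxE; ring.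
Qed.

Lemma sqr_le_shift2pi (x : R) (m : int) : `|x| <= pi ->
  x ^+ 2 <= (x - 2 * pi * m%:~R) ^+ 2.
Proof.
move=> xpi; have [->|m0] := eqVneq m 0; first by rewrite mulr0 subr0.
rewrite -[leLHS]real_normK ?num_real// -[leRHS]real_normK ?num_real//.
rewrite lerXn2r ?nnegrE//; apply: (le_trans xpi).
have m1 : 1 <= `|m%:~R| :> R by rewrite -intr_norm ler1z -gtz0_ge1 normr_gt0.
have p0 := @pi_ge0 R.
have : 2 * pi <= `|2 * pi * m%:~R| :> R.
  by rewrite normrM ger0_norm ?mulr_ge0// ler_peMr ?mulr_ge0.
have := lerB_dist (2 * pi * m%:~R) x; rewrite distrC.
move: xpi; lra.
Qed.

Lemma exists_period_shift (x : R) : exists m : int, `|x - 2 * pi * m%:~R| <= pi.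
Proof.
have p0 := @pi_gt0 R.
have [y xE] : exists y, x = 2 * pi * y.
  by exists (x / (2 * pi)); rewrite mulrC divfK// gt_eqF// mulr_gt0.
exists (Num.floor (y + 1 / 2)).
have := floorD1_gt (y + 1 / 2); have := floor_le (y + 1 / 2).
rewrite intrD; set f := (Num.floor _)%:~R => f1 f2.
have -> : x - 2 * pi * f = 2 * pi * (y - f) by rewrite xE; ring.
rewrite normrM ger0_norm ?mulr_ge0 ?pi_ge0// mulrAC -ler_pdivlMr// divff ?gt_eqF//.
suff : `|y - f| <= 1 / 2 by lra.
by rewrite ler_norml; apply/andP; split; lra.
Qed.

(** Let [c] hold the residues of the [<a_j, t>] modulo [2 pi]. For [y] in [Y], [A y = e_i] and
    integrality give [<y, c> = t_i] modulo [2 pi], and [|t_i| <= pi] makes [t_i] the smallest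
    representative. Averaging over [Y] yields [t_i^2 <= psi c <= rho ||c||^2], while [cos] sees only
    [c]. *)
Lemma char_fun_far d n (A : 'M[int]_(d, n)) (z : 'cV[R]_n) (t : 'cV[R]_d) i
    (Y : {fset 'cV[int]_n}) rho alpha :
  (forall j, 0 <= z j 0 <= 1) -> 0 < alpha ->
  (forall j, alpha <= z j 0 * (1 - z j 0)) ->
  Y != fset0 -> (forall y, y \in Y -> A *m y = delta_mx i 0) ->
  0 < rho -> (forall x, psi Y x <= rho * norm2 x ^+ 2) ->
  `|t i 0| <= pi ->
  Normc.normc (char_fun A z t) <= expR (- (alpha * t i 0 ^+ 2 / (20 * rho))).
Proof.
move=> z01 alpha0 zalpha Y0 AY rho0 psiY tpi.
pose s j := dotp (col j (toreal R A)) t.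
have /choice[m mP] j := exists_period_shift (s j).
pose c : 'cV[R]_n := \col_j (s j - 2 * pi * (m j)%:~R).
have psic : t i 0 ^+ 2 <= psi Y c.
  have Y1 : 0 < #|` Y|%:R :> R by rewrite ltr0n cardfs_gt0.
  rewrite /psi -(ler_pM2l Y1) [leRHS]mulrA divff ?gt_eqF// mul1r.
  have -> : #|` Y|%:R * t i 0 ^+ 2 = \sum_(y <- Y) t i 0 ^+ 2.
    by rewrite big_const_seq count_predT iter_addr_0 mulr_natl.
  rewrite !big_seq; apply: ler_sum => y yY.
  have -> : dotp (toreal R y) c =
      t i 0 - 2 * pi * (\sum_j y j 0 * m j)%:~R.
    have -> : t i 0 = dotp (toreal R (A *m y)) t.
      rewrite (AY _ yY) /dotp (bigD1 i)//= !mxE !eqxx mul1r big1 ?addr0// => k ki.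
      by rewrite !mxE (negbTE ki) mul0r.
    rewrite -dotp_toreal_mul rmorph_sum mulr_sumr -sumrB.
    by apply: eq_bigr => j _; rewrite !mxE rmorphM/= -/(s j); ring.
  exact: sqr_le_shift2pi.
have {psic} : t i 0 ^+ 2 <= rho * \sum_j c j 0 ^+ 2.
  apply: le_trans psic (le_trans (psiY c) _).
  by rewrite norm2_sqr.
move=> tc; apply: (@le_trans _ _ (expR (- (alpha / 20 * \sum_j c j 0 ^+ 2)))).
  rewrite mulr_sumr -sumrN expR_sum normc_prod; apply: ler_prod => j _.
  rewrite normc_ge0/=; apply: le_trans (normc_bernoulli_cf _ (z01 j)) _.
  rewrite ler_expR lerN2 -/(s j).
  have -> : cos (s j) = cos (c j 0).
    have := congr1 (@complex.Re R) (@expiD R (c j 0) (2 * pi * (m j)%:~R)).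
    by rewrite expi2pi_int mulr1 mxE subrK.
  have cpi : `|c j 0| <= pi by rewrite mxE; exact: mP.
  have := one_sub_cos_ge cpi => H.
  have -> : alpha / 20 * c j 0 ^+ 2 = alpha * (c j 0 ^+ 2 / 20) by ring.
  apply: ler_pM => //; first exact: ltW.
  by rewrite divr_ge0 ?sqr_ge0.
rewrite ler_expR lerN2 ler_pdivrMr ?mulr_gt0//.
have -> : alpha / 20 * (\sum_j c j 0 ^+ 2) * (20 * rho) =
  alpha * (rho * \sum_j c j 0 ^+ 2) by field.
by rewrite ler_pM2l.
Qed.

End FarRegion.

(** * Gaussian approximation near the origin *)

Section NearRegion.
Context {R : realType}.

Lemma near_pointwise n (v s : 'I_n -> R) (L M tau D : R) :
  let q := 2^-1 * \sum_j v j * s j ^+ 2 in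
  let T := expR (- q + \sum_j v j * s j ^+ 4 / 24) in
  (forall j, 0 <= v j) -> (forall j, `|s j| <= 1 / 4) ->
  1 / 2 <= L -> 0 < M -> 2 * M ^+ 2 * L <= 3 -> L / 3 <= tau ->
  D <= (\sum_j v j * `|s j| ^+ 3) * T -> D <= 2 * T ->
  D <= 16 * M * L * expR (- (1 - 1 / (4 * L)) * q)
     + 2 * expR (- (7 * L)) * expR (- (1 / 2) * q)
     + \sum_k 2 * expR (- (tau * M)) *
         (expR (2 * tau * s k - q) + expR (- (2 * tau * s k) - q)).
Proof.
move=> q T v0 s4 L2 M0 ML Ltau D1 D2.
set X1 := 16 * M * L * _; set X2 := 2 * _ * _; set X3 := \sum_k _.
have q0 : 0 <= q.
  by rewrite mulr_ge0// sumr_ge0// => j _; rewrite mulr_ge0 ?sqr_ge0.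
have L0 : 0 < L by lra.
have X10 : 0 <= X1.
  by rewrite /X1 mulr_ge0 ?expR_ge0// !mulr_ge0//; apply: ltW.
have X20 : 0 <= X2 by rewrite /X2 !mulr_ge0 ?expR_ge0.
have term0 k : 0 <= 2 * expR (- (tau * M)) *
   (expR (2 * tau * s k - q) + expR (- (2 * tau * s k) - q)).
  by rewrite !mulr_ge0 ?addr_ge0 ?expR_ge0.
have X30 : 0 <= X3 by apply: sumr_ge0.
have quartic B : (forall j, `|s j| <= B) ->
    \sum_j v j * s j ^+ 4 / 24 <= B ^+ 2 * q / 12.
  move=> sB; have -> : B ^+ 2 * q / 12 = \sum_j B ^+ 2 * (v j * s j ^+ 2) / 24.
    by rewrite -mulr_suml -mulr_sumr /q; field.
  apply: ler_sum => j _; rewrite ler_pM2r ?invr_gt0//.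
  have -> : v j * s j ^+ 4 = s j ^+ 2 * (v j * s j ^+ 2) by ring.
  apply: ler_wpM2r; first by rewrite mulr_ge0 ?sqr_ge0.
  rewrite -[leLHS]real_normK ?num_real// lerXn2r ?nnegrE//.
  exact: le_trans (sB j).
(* If all [|s j| <= M], the cubic sum is at most [2 M q] and the quartic one at most [q / (8 L)].
   The factor q is absorbed by [q <= 8 L exp (q / (8 L))], which lowers the coefficient of q by
   [1 / (4 L)] in total. *)
have [/forallP sM|] := boolP [forall j, `|s j| <= M].
  suff : D <= X1 by lra.
  apply: le_trans D1 _.
  have cubic : \sum_j v j * `|s j| ^+ 3 <= 2 * M * q.
    have -> : 2 * M * q = \sum_j M * (v j * s j ^+ 2).
      by rewrite -mulr_sumr /q; field.
    apply: ler_sum => j _.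
    have -> : v j * `|s j| ^+ 3 = `|s j| * (v j * s j ^+ 2).
      by rewrite -(real_normK (num_real (s j))); ring.
    by apply: ler_wpM2r; [rewrite mulr_ge0 ?sqr_ge0|exact: sM].
  have T1 : T <= expR (- q + q / (8 * L)).
    rewrite ler_expR lerD2l; apply: le_trans (quartic _ sM) _.
    rewrite ler_pdivlMr; last by rewrite mulr_gt0.
    have -> : M ^+ 2 * q / 12 * (8 * L) = (2 * M ^+ 2 * L) * q / 3 by field.
    by have := ler_wpM2r q0 ML; lra.
  have q1 : q <= 8 * L * expR (q / (8 * L)).
    have L8 : 0 < 8 * L by rewrite mulr_gt0.
    have := expR_ge1Dx (q / (8 * L)); rewrite -(ler_pM2l L8) mulrDr.
    by rewrite [_ * (q / _)]mulrC divfK ?gt_eqF//; lra.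
  have M20 : 0 <= 2 * M by lra.
  have cubic2 := le_trans cubic (ler_wpM2l M20 q1).
  apply: (@le_trans _ _ (2 * M * (8 * L * expR (q / (8 * L))) *
     expR (- q + q / (8 * L)))).
    apply: ler_pM => //; last exact: expR_ge0.
    by apply: sumr_ge0 => j _; rewrite mulr_ge0 ?exprn_ge0.
  have E : expR (- (1 - 1 / (4 * L)) * q) =
      expR (q / (8 * L)) * expR (- q + q / (8 * L)).
    by rewrite -expRD; congr expR; field; rewrite gt_eqF.
  by rewrite /X1 E le_eqVlt; apply/orP; left; apply/eqP; ring.
rewrite negb_forall => /existsP[k0]; rewrite -ltNge => k0M.
(* For [q >= 16 L] the quartic loss is at most [q / 192], so half of q remains after paying
   [7 L]. *)
have [q16|q16] := lerP (16 * L) q.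
  suff : D <= X2 by lra.
  apply: le_trans D2 _; rewrite /X2 -mulrA -expRD ler_pM2l// ler_expR.
  by have := quartic _ s4; lra.
suff : D <= X3 by lra.
apply: le_trans D2 _.
(* For the largest [|s k|], [q < 16 L] and [|s k| <= 1 / 4] bound the quartic loss by
   [|s k| L / 3 <= tau |s k|]. As [|s k| > M], a further [tau (|s k| - M)] may be added, giving the
   slope [2 tau]; both signs remove the absolute value. *)
have [k _ kmax] := @Order.TotalTheory.arg_maxP _ R 'I_n k0 predT (fun k => `|s k|) erefl.
have kM : M < `|s k| by apply: lt_le_trans k0M (kmax _ _).
have := quartic `|s k| (fun j => kmax j erefl) => Hq.
rewrite /X3 (bigD1 k)//=; apply: ler_wpDr; first exact: sumr_ge0.
rewrite -[leRHS]mulrA ler_pM2l//.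
have s0 : 0 <= `|s k| by [].
have E1 : `|s k| ^+ 2 * q / 12 <= tau * `|s k|.
  have : `|s k| * (`|s k| * q) <= `|s k| * (1 / 4 * (16 * L)).
    apply: ler_wpM2l => //.
    by apply: ler_pM; [exact: s0|exact: q0|exact: s4|exact: ltW].
  have := ler_wpM2r s0 Ltau; rewrite expr2; lra.
have t0 : 0 <= tau by lra.
have E2 : 0 <= tau * (`|s k| - M) by rewrite mulr_ge0// subr_ge0 ltW.
apply: (@le_trans _ _ (expR (- (tau * M)) * expR (2 * tau * `|s k| - q))).
  by rewrite -expRD ler_expR; lra.
rewrite ler_wpM2l ?expR_ge0//.
case: (ger0P (s k)) => _; first by rewrite lerDl expR_ge0.
by rewrite mulrN lerDr expR_ge0.
Qed.

End NearRegion.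

(** * Gaussian tails and constants *)

Section GaussianTails.
Context {R : realType}.
Implicit Types (d n K : nat) (h eta lambda r : R).

Lemma quadf_scaledmx d n (A : 'M[int]_(d, n)) (z : 'cV[R]_n) t :
  (forall j, 0 <= z j 0 <= 1) ->
  quadf (scaledmx A z *m (scaledmx A z)^T) t =
  \sum_j (z j 0 - z j 0 ^+ 2) * dotp (col j (toreal R A)) t ^+ 2.
Proof.
move=> z01; rewrite /quadf mulmxA -mulmxA -[X in _ *m X]trmxK.
rewrite trmx_mul trmxK mxE; apply: eq_bigr => j _.
have v0 : 0 <= z j 0 - z j 0 ^+ 2.
  by have /andP[? ?] := z01 j; rewrite subr_ge0 expr2 ler_piMl.
set x := (t^T *m _) 0 j; have -> : (t^T *m scaledmx A z)^T j 0 = x by rewrite mxE.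
rewrite -expr2; have -> : x = Num.sqrt (z j 0 - z j 0 ^+ 2) * dotp (col j (toreal R A)) t.
  rewrite /x mxE /dotp mulr_sumr; apply: eq_bigr => i _.
  by rewrite !mxE; ring.
by rewrite exprMn sqr_sqrtr.
Qed.

Lemma qform_quadf d n (A : 'M[int]_(d, n)) (z : 'cV[R]_n) t :
  (forall j, 0 <= z j 0 <= 1) ->
  qform A z t = quadf (scaledmx A z *m (scaledmx A z)^T) t / 2.
Proof. by move=> z01; rewrite quadf_scaledmx// mulrC. Qed.

Lemma dotp_gt0 d (t : 'cV[R]_d) : t != 0 -> 0 < dotp t t.
Proof.
move=> t0; rewrite lt0r; apply/andP; split; last first.
  by apply: sumr_ge0 => i _; rewrite -expr2 sqr_ge0.
apply: contra t0 => /eqP H; apply/eqP/matrixP => i j; rewrite (ord1 j) mxE.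
have /(_ i) : forall i, true -> t i 0 * t i 0 = 0.
  by apply/psumr_eq0P => // k _; rewrite -expr2 sqr_ge0.
by move=> /(_ erefl) /eqP; rewrite mulf_eq0 orbb => /eqP.
Qed.

Lemma posdef_coercive d (Q : 'M[R]_d) lambda : Q^T = Q -> 0 < lambda ->
  (forall t, lambda * dotp t t <= quadf Q t / 2) -> posdef Q.
Proof.
move=> Qs l0 QL; split=> // t /dotp_gt0 t0.
by have := QL t; have := mulr_gt0 l0 t0; lra.
Qed.

(** The mass of [c *: Q] is [c^(- d / 2)] times that of [Q]. *)
Lemma gauss_mass_scale_le d (Q : 'M[R]_d) (c y : R) : posdef Q -> 0 < c ->
  expR (- (2 * y)) <= c ^+ d ->
  gauss_mass (c *: Q) <= expR y * gauss_mass Q.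
Proof.
move=> Qp c0 cd; rewrite /gauss_mass detZ [Num.sqrt (c ^+ d * _)]sqrtrM ?exprn_ge0 ?(ltW c0)//.
have s0 : 0 < Num.sqrt (c ^+ d) by rewrite sqrtr_gt0 exprn_gt0.
have D0 : 0 < Num.sqrt (\det Q) by rewrite sqrtr_gt0 posdef_det.
have : expR (- y) <= Num.sqrt (c ^+ d).
  rewrite -[leLHS]ger0_norm ?expR_ge0// -sqrtr_sqr ler_sqrt ?exprn_ge0 ?(ltW c0)//.
  by rewrite -expRM_natl mulrN.
rewrite expRN => H; rewrite invfM [leRHS]mulrCA; apply: ler_wpM2l.
  by rewrite exprn_ge0 ?sqrtr_ge0.
apply: ler_wpM2r; first by rewrite invr_ge0 ltW.
by rewrite -[leRHS]invrK lef_pV2// posrE// invr_gt0 expR_gt0.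
Qed.

(** Supplies, by completing a square, the bound [C] required by [gridsum_gauss_le]. *)
Lemma dotp_subquad_le d (Q : 'M[R]_d) lambda (u t : 'cV[R]_d) U : 0 < lambda ->
  (forall t, lambda * dotp t t <= quadf Q t / 2) -> dotp u u <= U ->
  dotp u t - quadf Q t / 2 <= U / (4 * lambda).
Proof.
move=> l0 QL uU.
have l4 : 0 < 4 * lambda by rewrite mulr_gt0.
have : dotp u t <= dotp u u / (4 * lambda) + lambda * dotp t t.
  rewrite /dotp mulr_suml mulr_sumr -big_split/=; apply: ler_sum => i _.
  set a := u i ord0; set b := t i ord0.
  rewrite -subr_ge0.
  have -> : a * a / (4 * lambda) + lambda * (b * b) - a * b =
    (a - 2 * lambda * b) ^+ 2 / (4 * lambda) by field; rewrite gt_eqF.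
  by rewrite divr_ge0 ?sqr_ge0// ltW.
have : dotp u u / (4 * lambda) <= U / (4 * lambda).
  by rewrite ler_pM2r// invr_gt0.
by have := QL t; lra.
Qed.

Definition inbox d r (t : 'cV[R]_d) := [forall i, `|t i 0| <= r].

(** The condition is only [r <= h K]: the lower bound is taken on the grid of extent [K0], possibly
    far beyond [K], the part outside the box is subtracted there, and the boxed sum is carried back
    by [gridsum_embed]. *)
Lemma gauss_box_sum d (Q : 'M[R]_d) lambda r eta :
  posdef Q -> 0 < lambda -> (forall t, lambda * dotp t t <= quadf Q t / 2) ->
  0 < r -> 0 < eta ->
  exists2 h0, 0 < h0 & forall h K, 0 < h -> h <= h0 -> r <= h * K%:R ->
   `|gridsum h K (fun t => if inbox r t then expR (- (quadf Q t / 2)) else 0)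
      - gauss_mass Q| <=
   eta + 2 * d%:R * expR (- (lambda * r ^+ 2)) * (gauss_mass Q + eta).
Proof.
move=> Qp l0 QL r0 eta0.
have [h1 h10 H1] := gridsum_gauss_le Qp eta0.
have [h2 h20 H2] := gridsum_gauss_ge Qp eta0.
exists (Num.min h1 h2) => [|h K h0]; first by rewrite lt_min h10.
rewrite le_min => /andP[hh1 hh2] rK.
have [K0 HK0] := H2 h h0 hh2.
set G := gauss_mass Q in H1 H2 HK0 *.
have G0 : 0 < G by exact: gauss_mass_gt0.
pose f t := if inbox r t then expR (- (quadf Q t / 2)) else 0.
have f0 t : 0 <= f t by rewrite /f; case: ifP => // _; exact: expR_ge0.
have fE t : f t <= expR (dotp 0 t - quadf Q t / 2).
  by rewrite dotp0l sub0r /f; case: ifP => // _; exact: expR_ge0.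
have up : gridsum h K f <= G + eta.
  apply: (@le_trans _ _ (gridsum h K (fun t => expR (dotp 0 t - quadf Q t / 2)))).
    by apply: gridsum_le; [exact: ltW|move=> k; exact: fE].
  have := H1 h K 0 0 h0 hh1; rewrite expR0 mul1r; apply=> t.
  have := @dotp_subquad_le d Q lambda 0 t 0 l0 QL.
  by rewrite dotp0l mul0r; apply.
have emb : gridsum h K0 f <= gridsum h K f.
  apply: gridsum_embed => // k; rewrite /f; case: ifP => [/forallP near _ i|_].
    exact: le_trans (near i) rK.
  by rewrite eqxx.
(* Minimizes [c^2 / (4 lambda) - c r], with minimum [- lambda r^2]. *)
pose c := 2 * lambda * r.
pose u i : 'cV[R]_d := c *: delta_mx i 0.
have uE i t : dotp (u i) t = c * t i 0.
  rewrite dotpZl; congr (_ * _); rewrite /dotp (bigD1 i)//= !mxE !eqxx mul1r.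
  by rewrite big1 ?addr0// => k ki; rewrite !mxE (negbTE ki) mul0r.
have uu i : dotp (u i) (u i) <= c ^+ 2.
  by rewrite uE !mxE !eqxx mulr1 expr2.
have uu' i : dotp (- u i) (- u i) <= c ^+ 2.
  by rewrite dotpNl dotpC dotpNl opprK.
pose g t := \sum_i expR (- (c * r)) *
  (expR (dotp (u i) t - quadf Q t / 2) + expR (dotp (- u i) t - quadf Q t / 2)).
have fg t : expR (- (quadf Q t / 2)) <= f t + g t.
  have g0 (i : 'I_d) : 0 <= expR (- (c * r)) *
      (expR (dotp (u i) t - quadf Q t / 2) + expR (dotp (- u i) t - quadf Q t / 2)).
    by rewrite mulr_ge0 ?addr_ge0 ?expR_ge0.
  rewrite /f; case: ifP => [_|/negbT]; first by rewrite lerDl sumr_ge0.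
  rewrite /inbox => /forallPn[j]; rewrite -ltNge => ti.
  rewrite add0r /g (bigD1 j)//=; apply: ler_wpDr; first exact: sumr_ge0.
  rewrite dotpNl uE mulrDr -!expRD.
  have c0 : 0 < c by rewrite !mulr_gt0.
  case: (ger0P (t j 0)) ti => ti0 ti; have := ler_wpM2l (ltW c0) (ltW ti) => cti.
    by apply: ler_wpDr; [exact: expR_ge0|rewrite ler_expR; lra].
  by apply: ler_wpDl; [exact: expR_ge0|rewrite ler_expR; lra].
have gU : gridsum h K0 g <= 2 * d%:R * expR (- (lambda * r ^+ 2)) * (G + eta).
  rewrite gridsum_sum.
  have -> : 2 * d%:R * expR (- (lambda * r ^+ 2)) * (G + eta) =
    \sum_(i < d) expR (- (c * r)) * (2 * (expR (c ^+ 2 / (4 * lambda)) * (G + eta))).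
    rewrite sumr_const card_ord -[_ *+ d]mulr_natr.
    have -> : expR (- (lambda * r ^+ 2)) =
      expR (- (c * r)) * expR (c ^+ 2 / (4 * lambda)).
      by rewrite -expRD; congr expR; rewrite /c; field; rewrite gt_eqF.
    ring.
  apply: ler_sum => i _; rewrite gridsumZ ler_wpM2l ?expR_ge0// gridsumD.
  have := H1 h K0 (u i) _ h0 hh1 (fun t => @dotp_subquad_le d Q lambda (u i) t _ l0 QL (uu i)).
  have := H1 h K0 (- u i) _ h0 hh1 (fun t => @dotp_subquad_le d Q lambda (- u i) t _ l0 QL (uu' i)).
  lra.
have lo : G - eta <= gridsum h K0 f + gridsum h K0 g.
  apply: le_trans (HK0 _ (leqnn _)) _; rewrite -gridsumD.
  by apply: gridsum_le; [exact: ltW|].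
have d0 : 0 <= 2 * d%:R * expR (- (lambda * r ^+ 2)) * (G + eta).
  by rewrite !mulr_ge0 ?expR_ge0//; lra.
by rewrite ler_norml -/f; apply/andP; split; lra.
Qed.

Lemma ln2_ge : 1 / 2 <= ln 2 :> R.
Proof.
rewrite -ler_expR lnK ?posrE//.
have := expR_ge1Dx (- (1 / 2) : R); rewrite expRN.
have E0 := expR_gt0 (1 / 2 : R).
by rewrite -(ler_pM2r E0) mulVf ?gt_eqF//; lra.
Qed.

(** [M] is set by [16 M L = eps / 32], and [tau] by [tau M = 8 Lam]. Then
    [tau^2 theta^2 <= 4 lambda Lam] reads [2^24 theta^2 Lam^2 L^2 / eps^2 <= 4 lambda Lam], which is
    where [2^22] comes from. The last bound says [7 Lam <= lambda r^2] for the box of half-side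
    [r = 1 / (2 theta)]. *)
Lemma numeric_bounds (eps theta lambda L Lam M tau : R) d n :
  0 < eps -> eps <= 1 / 2 -> 1 <= theta -> (d < n)%N ->
  L = d%:R + ln (1 / eps) -> Lam = ln (n%:R / eps) ->
  M = eps / (2 ^+ 9 * L) -> tau = 8 * Lam / M ->
  2 ^+ 22 * eps ^- 2 * theta ^+ 2 * L ^+ 2 * Lam <= lambda ->
  [/\ 1 / 2 <= L, d%:R <= L, expR (- L) <= eps & 1 / 2 <= Lam] /\
  [/\ n%:R * expR (- Lam) = eps, expR (- Lam) <= eps, 0 < M &
      2 * M ^+ 2 * L <= 3] /\
  [/\ L / 3 <= tau, 16 * M * L = eps / 32, tau * M = 8 * Lam,
      tau ^+ 2 * theta ^+ 2 <= 4 * lambda * Lam &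
      28 * theta ^+ 2 * Lam <= lambda].
Proof.
move=> e0 e2 th1 dn LE LamE ME tauE lamge.
have n1 : 1 <= n%:R :> R by rewrite ler1n (leq_ltn_trans _ dn).
have n0 : 0 < n%:R :> R by lra.
have le0 : 0 < 1 / eps by rewrite divr_gt0.
have ne0 : 0 < n%:R / eps by rewrite divr_gt0.
have lne : 1 / 2 <= ln (1 / eps).
  apply: le_trans ln2_ge _; rewrite ler_ln ?posrE//.
  by rewrite ler_pdivlMr//; lra.
have d0 : 0 <= d%:R :> R by [].
have L2 : 1 / 2 <= L by lra.
have L0 : 0 < L by lra.
have Lam_ge : ln (1 / eps) <= Lam.
  by rewrite LamE ler_ln ?posrE// ler_pM2r// invr_gt0.
have c0 : 0 < 2 ^+ 9 :> R by rewrite exprn_gt0.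
have M0 : 0 < M by rewrite ME; apply: divr_gt0 => //; exact: mulr_gt0.
have nLam : n%:R * expR (- Lam) = eps.
  by rewrite LamE expRN lnK ?posrE// invf_div mulrCA divff ?gt_eqF// mulr1.
have expe : expR (- ln (1 / eps)) = eps.
  by rewrite expRN lnK ?posrE// div1r invrK.
have tauM : tau * M = 8 * Lam by rewrite tauE divfK// gt_eqF.
have ML : 2 ^+ 9 * (M * L) = eps by rewrite ME; field; rewrite gt_eqF.
split; [split|split; split] => //.
- by rewrite LE lerDl; lra.
- by rewrite -[leRHS]expe ler_expR lerN2; lra.
- by lra.
- by rewrite -[leRHS]expe ler_expR lerN2.
- have : M ^+ 2 * L * (1 / 2) <= M ^+ 2 * L * L.
    by rewrite ler_wpM2l// mulr_ge0 ?sqr_ge0// ltW.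
  have -> : M ^+ 2 * L * L = (M * L) * (M * L) by ring.
  have ML0 : 0 <= M * L by rewrite mulr_ge0 ?(ltW M0) ?(ltW L0).
  have : (M * L) * (M * L) <= 1 / 2 * (1 / 2) by apply: ler_pM; lra.
  lra.
- rewrite -(ler_pM2r M0) tauM; have -> : L / 3 * M = (M * L) / 3 by ring.
  lra.
- by lra.
- have M2 : 0 < M ^+ 2 by rewrite exprn_gt0.
  rewrite -(ler_pM2r M2).
  have -> : tau ^+ 2 * theta ^+ 2 * M ^+ 2 = (tau * M) ^+ 2 * theta ^+ 2 by ring.
  rewrite tauM; apply: (@le_trans _ _
    (4 * (2 ^+ 22 * eps ^- 2 * theta ^+ 2 * L ^+ 2 * Lam) * Lam * M ^+ 2)).
    have -> : 4 * (2 ^+ 22 * eps ^- 2 * theta ^+ 2 * L ^+ 2 * Lam) * Lam * M ^+ 2 =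
      2 ^+ 24 * theta ^+ 2 * Lam ^+ 2 * (M * L) ^+ 2 / eps ^+ 2 by ring.
    rewrite -ML le_eqVlt; apply/orP; left; apply/eqP; field.
    by rewrite !gt_eqF.
  by rewrite ler_pM2r// ler_pM2r ?ler_pM2l//; lra.
- apply: le_trans lamge.
  have X1 : 28 <= 2 ^+ 22 * eps ^- 2 * L ^+ 2.
    have H1 : 4 <= eps ^- 2.
      rewrite -[leLHS]invrK lef_pV2 ?posrE ?invr_gt0 ?exprn_gt0//.
      have : eps * eps <= 1 / 2 * (1 / 2) by apply: ler_pM => //; exact: ltW.
      by rewrite expr2; lra.
    have H2 : 1 / 4 <= L ^+ 2.
      have : 1 / 2 * (1 / 2) <= L * L by apply: ler_pM.
      by rewrite expr2; lra.
    have : 4 * (1 / 4) <= eps ^- 2 * L ^+ 2 by apply: ler_pM.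
    lra.
  have X2 : 0 <= theta ^+ 2 * Lam by rewrite mulr_ge0 ?sqr_ge0//; lra.
  have := ler_wpM2r X2 X1.
  have -> : 2 ^+ 22 * eps ^- 2 * L ^+ 2 * (theta ^+ 2 * Lam) =
    2 ^+ 22 * eps ^- 2 * theta ^+ 2 * L ^+ 2 * Lam by ring.
  by rewrite mulrA.
Qed.

End GaussianTails.

(** * The local limit theorem *)

Section LocalLimit.
Context {R : realType}.
Implicit Types (d n K : nat).

(* The three terms dominate, respectively: the points where all the [|<a_j, t>|]
   are at most [M]; those where [q] is at least [16 L]; the others. *)
Definition error_bound d n (Q : 'M[R]_d) (u : 'I_n -> 'cV[R]_d)
    (L M tauM : R) (t : 'cV[R]_d) : R :=
  16 * M * L * expR (dotp 0 t - quadf ((1 - 1 / (4 * L)) *: Q) t / 2)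
  + 2 * expR (- (7 * L)) * expR (dotp 0 t - quadf (2^-1 *: Q) t / 2)
  + \sum_k 2 * expR (- tauM) *
      (expR (dotp (u k) t - quadf Q t / 2) +
       expR (dotp (- u k) t - quadf Q t / 2)).

Lemma expR_quarter_le2 : expR (1 / 4) <= 2 :> R.
Proof.
have := expR_ge1Dx (- (1 / 4) : R); rewrite expRN => H.
have E0 := expR_gt0 (1 / 4 : R).
have : 3 / 4 * expR (1 / 4 : R) <= 1.
  by rewrite -ler_pdivlMr// [leRHS]div1r; apply: le_trans H; lra.
lra.
Qed.

Lemma expR_le_one_sub (x : R) : 0 <= x -> x <= 1 / 2 -> expR (- (2 * x)) <= 1 - x.
Proof.
move=> x0 x2; have E0 := expR_gt0 (2 * x).
rewrite expRN -(ler_pM2r E0) mulVf ?gt_eqF//.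
have x1 : 0 <= 1 - x by lra.
have := ler_wpM2l x1 (expR_ge1Dx (2 * x)).
have : 0 <= x * (1 / 2 - x) by apply: mulr_ge0; lra.
lra.
Qed.

Lemma posdef_quadf_ge0 d (Q : 'M[R]_d) t : posdef Q -> 0 <= quadf Q t.
Proof.
move=> [_ Qp]; have [->|/Qp/ltW//] := eqVneq t 0.
by rewrite /quadf mulmx0 mxE.
Qed.

(** The budget is [3 / 32 + 4 / 32 + 4 / 32]. Rescaling Q costs at most 2 in the first term and
    [exp L] in the second; in the third the linear terms cost [exp Lam] each, and another
    [exp (- Lam)] pays for the union over the n columns. *)
Lemma error_bound_sum d n (Q : 'M[R]_d) (u : 'I_n -> 'cV[R]_d)
    (lambda eps L Lam M tauM : R) :
  posdef Q -> 0 < lambda -> (forall t, lambda * dotp t t <= quadf Q t / 2) ->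
  (forall k, dotp (u k) (u k) <= 4 * lambda * Lam) ->
  eps <= 1 / 2 -> 1 / 2 <= L -> d%:R <= L -> expR (- L) <= eps ->
  n%:R * expR (- Lam) = eps -> expR (- Lam) <= eps ->
  16 * M * L = eps / 32 -> tauM = 8 * Lam ->
  exists2 h0, 0 < h0 & forall h K, 0 < h -> h <= h0 ->
    gridsum h K (error_bound Q u L M tauM) <= 11 / 32 * eps * gauss_mass Q.
Proof.
move=> Qp l0 QL uL e2 L2 dL eL nLam eLam ML tauME.
have G0 := gauss_mass_gt0 Qp; set G := gauss_mass Q in G0 *.
have L0 : 0 < L by lra.
have e0 : 0 <= eps by apply: le_trans eL; exact: expR_ge0.
set x := 1 / (4 * L).
have xL : x * L = 1 / 4 by rewrite /x; field; rewrite gt_eqF.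
have x0 : 0 < x by rewrite divr_gt0// mulr_gt0.
have x2 : x <= 1 / 2.
  have : x * (1 / 2) <= x * L by rewrite ler_pM2l.
  lra.
have Qp1 : posdef ((1 - x) *: Q) by apply: posdefZ => //; lra.
have Qp2 : posdef (2^-1 *: Q) by apply: posdefZ.
have mass1 : gauss_mass ((1 - x) *: Q) <= 2 * G.
  apply: le_trans (ler_wpM2r (ltW G0) expR_quarter_le2).
  apply: gauss_mass_scale_le => //; first by lra.
  apply: (@le_trans _ _ (expR (- (2 * x)) ^+ d)).
    rewrite -expRM_natr ler_expR.
    have : x * d%:R <= x * L by rewrite ler_pM2l.
    lra.
  rewrite lerXn2r ?nnegrE ?expR_ge0//; first by lra.
  by apply: expR_le_one_sub => //; exact: ltW.
have mass2 : gauss_mass (2^-1 *: Q) <= expR L * G.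
  apply: gauss_mass_scale_le => //.
  apply: (@le_trans _ _ (expR (- 2) ^+ d)).
    by rewrite -expRM_natr ler_expR; lra.
  rewrite lerXn2r ?nnegrE ?expR_ge0 ?invr_ge0// expRN lef_pV2 ?posrE ?expR_gt0//.
  by have := expR_ge1Dx (2 : R); lra.
(* Error terms matter only up to a constant factor, so [G] itself serves as the tolerance. *)
have [h1 h10 H1] := gridsum_gauss_le Qp1 G0.
have [h2 h20 H2] := gridsum_gauss_le Qp2 G0.
have [h3 h30 H3] := gridsum_gauss_le Qp G0.
exists (Num.min h1 (Num.min h2 h3)) => [|h K h0].
  by rewrite !lt_min h10 h20.
rewrite !le_min => /and3P[hh1 hh2 hh3].
rewrite !gridsumD !gridsumZ gridsum_sum.
have C0 (Q' : 'M[R]_d) : posdef Q' -> forall t, dotp 0 t - quadf Q' t / 2 <= 0.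
  move=> Q'p t; rewrite dotp0l sub0r oppr_le0 divr_ge0//.
  exact: posdef_quadf_ge0.
have {}H1 := H1 h K 0 0 h0 hh1 (C0 _ Qp1).
have {}H2 := H2 h K 0 0 h0 hh2 (C0 _ Qp2).
rewrite expR0 mul1r in H1; rewrite expR0 mul1r in H2.
set S1 := gridsum h K _ in H1 *; set S2 := gridsum h K _ in H2 *.
have T1 : 16 * M * L * S1 <= 3 / 32 * eps * G.
  have : eps * S1 <= eps * (3 * G) by apply: ler_wpM2l => //; lra.
  by rewrite ML; lra.
have eL1 : 1 <= expR L by have := expR_ge1Dx L; lra.
(* One power yields [eps], the other five [1 / 32]. A sixth power is what remains of [7 L] after the
   mass factor, and of [8 Lam] after the tilt and the union. *)
have pow6 y : expR (- y) <= eps -> expR (- y) ^+ 6 <= eps / 32.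
  move=> ye; rewrite exprS.
  have y0 := expR_ge0 (- y).
  have : expR (- y) ^+ 5 <= (1 / 2) ^+ 5.
    by rewrite lerXn2r ?nnegrE//; lra.
  have y50 : 0 <= expR (- y) ^+ 5 by exact: exprn_ge0.
  move=> y5; have : expR (- y) * expR (- y) ^+ 5 <= eps * (1 / 2) ^+ 5.
    exact: ler_pM.
  lra.
have T2 : 2 * expR (- (7 * L)) * S2 <= 1 / 8 * eps * G.
  have E7 : expR (- (7 * L)) * expR L = expR (- L) ^+ 6.
    by rewrite -expRD -expRM_natr; congr expR; ring.
  have S2L : S2 <= 2 * (expR L * G).
    have : 1 * G <= expR L * G by rewrite ler_pM2r.
    lra.
  have := ler_wpM2l (expR_ge0 (- (7 * L))) S2L.
  have -> : expR (- (7 * L)) * (2 * (expR L * G)) =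
    2 * (expR (- (7 * L)) * expR L) * G by ring.
  rewrite E7 => H.
  have : expR (- L) ^+ 6 * G <= eps / 32 * G by rewrite ler_pM2r// pow6.
  lra.
have T3 : \sum_(k < n) gridsum h K (fun t => 2 * expR (- tauM) *
      (expR (dotp (u k) t - quadf Q t / 2) +
       expR (dotp (- u k) t - quadf Q t / 2))) <= 1 / 8 * eps * G.
  apply: (@le_trans _ _ (\sum_(k < n) 2 * expR (- tauM) * (4 * expR Lam * G))).
    apply: ler_sum => k _; rewrite gridsumZ ler_wpM2l ?mulr_ge0 ?expR_ge0//.
    rewrite gridsumD.
    have LamE : 4 * lambda * Lam / (4 * lambda) = Lam.
      by field; rewrite gt_eqF.
    have uk' : dotp (- u k) (- u k) <= 4 * lambda * Lam.
      by rewrite dotpNl dotpC dotpNl opprK.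
    have := H3 h K (u k) _ h0 hh3
      (fun t => @dotp_subquad_le _ d Q lambda (u k) t _ l0 QL (uL k)).
    have := H3 h K (- u k) _ h0 hh3
      (fun t => @dotp_subquad_le _ d Q lambda (- u k) t _ l0 QL uk').
    rewrite !LamE -/G; lra.
  rewrite sumr_const card_ord -[_ *+ n]mulr_natr.
  have E : expR (- tauM) * expR Lam = expR (- Lam) ^+ 6 * expR (- Lam).
    by rewrite -expRM_natr -!expRD tauME; congr expR; ring.
  have -> : 2 * expR (- tauM) * (4 * expR Lam * G) * n%:R =
    8 * (expR (- tauM) * expR Lam) * n%:R * G by ring.
  rewrite E; have -> : 8 * (expR (- Lam) ^+ 6 * expR (- Lam)) * n%:R * G =
    8 * expR (- Lam) ^+ 6 * (n%:R * expR (- Lam)) * G by ring.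
  rewrite nLam ler_pM2r// mulrC [leRHS]mulrC ler_wpM2l//.
  by have := pow6 _ eLam; lra.
apply: le_trans (lerD (lerD T1 T2) T3) _.
by rewrite le_eqVlt; apply/orP; left; apply/eqP; field.
Qed.

Lemma gauss_box_sum_small d n (Q : 'M[R]_d) (lambda r eps Lam : R) :
  posdef Q -> 0 < lambda -> (forall t, lambda * dotp t t <= quadf Q t / 2) ->
  0 < r -> (d <= n)%N -> 0 < eps -> eps <= 1 / 2 ->
  n%:R * expR (- Lam) = eps -> expR (- Lam) <= eps ->
  7 * Lam <= lambda * r ^+ 2 ->
  exists2 h0, 0 < h0 & forall h K, 0 < h -> h <= h0 -> r <= h * K%:R ->
   `|gridsum h K (fun t => if inbox r t then expR (- (quadf Q t / 2)) else 0)
      - gauss_mass Q| <= 4 / 32 * eps * gauss_mass Q.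
Proof.
move=> Qp l0 QL r0 dn e0 e2 nLam eLam lr.
have G0 := gauss_mass_gt0 Qp; set G := gauss_mass Q in G0 *.
have eta0 : 0 < eps / 32 * G by rewrite mulr_gt0// divr_gt0.
have [h0 h00 H0] := gauss_box_sum Qp l0 QL r0 eta0.
exists h0 => // h K hp hh0 rK; apply: le_trans (H0 h K hp hh0 rK) _; rewrite -/G.
have E1 : expR (- (lambda * r ^+ 2)) <= expR (- Lam) * (1 / 2) ^+ 6.
  apply: (@le_trans _ _ (expR (- (7 * Lam)))); first by rewrite ler_expR; lra.
  have -> : expR (- (7 * Lam)) = expR (- Lam) * expR (- Lam) ^+ 6.
    by rewrite -expRM_natr -expRD; congr expR; ring.
  rewrite ler_wpM2l ?expR_ge0// lerXn2r ?nnegrE ?expR_ge0//.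
  exact: le_trans e2.
have E2 : d%:R * expR (- (lambda * r ^+ 2)) <= eps * (1 / 2) ^+ 6.
  by rewrite -nLam -mulrA; apply: ler_pM => //; rewrite ler_nat.
have E3 : G + eps / 32 * G <= 2 * G.
  have : eps / 32 * G <= G by rewrite ler_piMl// ?(ltW G0)//; lra.
  lra.
have E4 : 0 <= d%:R * expR (- (lambda * r ^+ 2)) by rewrite mulr_ge0 ?expR_ge0.
have E5 : 0 <= G + eps / 32 * G by rewrite addr_ge0 ?ltW.
have := ler_pM E4 E5 E2 E3; have := mulr_gt0 e0 G0; lra.
Qed.

Lemma grid_bound d K (k : {ffun 'I_d -> 'I_(K.*2.+1)}) i :
  `|grid (2 * pi / K.*2.+1%:R) k i 0| <= pi :> R.
Proof.
have p0 := @pi_gt0 R.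
rewrite mxE; have : (k i <= K.*2)%N by rewrite -ltnS.
move: (nat_of_ord (k i)) => m mK.
have N0 : 0 < K.*2.+1%:R :> R by rewrite ltr0n.
have h0 : 0 <= 2 * pi / K.*2.+1%:R :> R by rewrite divr_ge0 ?mulr_ge0 ?pi_ge0.
rewrite normrM (ger0_norm h0) mulrAC ler_pdivrMr//.
have NE : K.*2.+1%:R = 2 * K%:R + 1 :> R by rewrite -natr1 -mul2n natrM.
rewrite mulrAC [leRHS]mulrC ler_pM2r//.
have : `|m%:R - K%:R| <= K%:R :> R.
  have := ler0n R m; move: mK; rewrite -(ler_nat R) -mul2n natrM => ? ?.
  by rewrite ler_norml; apply/andP; split; lra.
by rewrite NE; lra.
Qed.

Lemma dotp_le_norm1 d (u : 'cV[R]_d) : dotp u u <= norm1 u ^+ 2.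
Proof.
rewrite expr2 {1}/norm1 mulr_suml; apply: ler_sum => i _.
rewrite -expr2 -[leLHS]real_normK ?num_real// expr2 ler_wpM2l//.
by rewrite /norm1 (bigD1 i)//= lerDl sumr_ge0.
Qed.

Lemma dotp_inbox d (u t : 'cV[R]_d) r : inbox r t -> `|dotp u t| <= norm1 u * r.
Proof.
move=> /forallP tr; apply: le_trans (ler_norm_sum _ _ _) _.
rewrite mulr_suml; apply: ler_sum => i _; rewrite normrM.
by rewrite ler_wpM2l//; exact: tr.
Qed.

End LocalLimit.

(** * Comparison with the characteristic function and the final count *)

Section Assembly.
Context {R : realType}.
Implicit Types (d n K : nat).

Lemma char_fun_near d n (A : 'M[int]_(d, n)) (z : 'cV[R]_n) (t : 'cV[R]_d)
    theta L M tau :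
  let Q := scaledmx A z *m (scaledmx A z)^T in
  (forall j, 0 <= z j 0 <= 1) -> 1 <= theta ->
  (forall j, norm1 (col j (toreal R A)) <=
     theta * Num.sqrt (z j 0 * (1 - z j 0))) ->
  1 / 2 <= L -> 0 < M -> 2 * M ^+ 2 * L <= 3 -> L / 3 <= tau ->
  inbox (1 / (2 * theta)) t ->
  Normc.normc (char_fun A z t - real_complex R (expR (- (quadf Q t / 2)))) <=
  error_bound Q (fun j => (2 * tau) *: col j (toreal R A)) L M (tau * M) t.
Proof.
move=> Q z01 th1 normA L2 M0 ML Ltau near.
pose v j := z j 0 * (1 - z j 0).
pose s j := dotp (col j (toreal R A)) t.
have v0 j : 0 <= v j.
  by have /andP[? ?] := z01 j; rewrite mulr_ge0// subr_ge0.
have v4 j : v j <= 1 / 4.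
  by rewrite /v; have := sqr_ge0 (z j 0 - 1 / 2); rewrite sqrrB; lra.
have th0 : 0 < theta by lra.
(* The bound on [norm1] contributes [theta * sqrt (v j) <= theta / 2], the box [1 / (2 theta)]. *)
have s4 j : `|s j| <= 1 / 4.
  apply: le_trans (dotp_inbox _ near) _.
  rewrite mulrA mulr1 ler_pdivrMr ?mulr_gt0//.
  apply: le_trans (normA j) _; rewrite -/(v j).
  have : Num.sqrt (v j) <= 1 / 2.
    rewrite -[leRHS]ger0_norm// -sqrtr_sqr ler_sqrt ?sqr_ge0//.
    by apply: le_trans (v4 j) _; rewrite expr2; lra.
  by move=> /(ler_wpM2l (ltW th0)); lra.
have qE : quadf Q t / 2 = 2^-1 * \sum_j v j * s j ^+ 2.
  rewrite mulrC quadf_scaledmx//; congr (_ * _); apply: eq_bigr => j _.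
  by rewrite /v -/(s j); ring.
have [D1 D2] := bernoulli_cf_prod z01 s4.
have := near_pointwise v0 s4 L2 M0 ML Ltau D1 D2.
rewrite -/(char_fun A z t) -qE; move=> H; apply: le_trans H _.
rewrite /error_bound !dotp0l !sub0r !quadfZ.
rewrite le_eqVlt; apply/orP; left; apply/eqP; congr (_ + _ + _).
- by congr (_ * expR _); ring.
- by congr (_ * expR _); field.
- by apply: eq_bigr => j _; rewrite dotpNl dotpZl -/(s j).
Qed.

(** The inversion sum and the boxed Gaussian sum are compared point by point on one grid; the errors
    [11 / 32] and [4 / 32] stay below 1. Both sides are kept multiplied by [(2 pi)^d]. *)
Lemma local_limit d n (A : 'M[int]_(d, n)) (b : 'cV[int]_d) (z : 'cV[R]_n)
    (Y : 'I_d -> {fset 'cV[int]_n}) (lambda rho theta alpha eps : R) :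
  let Q := scaledmx A z *m (scaledmx A z)^T in
  (d < n)%N -> toreal R A *m z = toreal R b -> (forall j, 0 <= z j 0 <= 1) ->
  (forall i : 'I_d, Y i != fset0) ->
  (forall (i : 'I_d) (y : 'cV[int]_n), y \in Y i -> A *m y = delta_mx i 0) ->
  0 < lambda -> (forall t, lambda * dotp t t <= quadf Q t / 2) ->
  0 < rho ->
  (forall (i : 'I_d) (x : 'cV[R]_n), psi (Y i) x <= rho * norm2 x ^+ 2) ->
  1 <= theta ->
  (forall j, norm1 (col j (toreal R A)) <=
     theta * Num.sqrt (z j 0 * (1 - z j 0))) ->
  0 < alpha -> (forall j, alpha <= z j 0 * (1 - z j 0)) ->
  0 < eps -> eps <= 1 / 2 ->
  2 ^+ 22 * eps ^- 2 * theta ^+ 2 * (d%:R + ln (1 / eps)) ^+ 2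
    * ln (n%:R / eps) <= lambda ->
  `|(2 * pi) ^+ d *
      (\sum_(x : {ffun 'I_n -> bool} | A *m bits x == b) bernoulli_pmf z x)
    - gauss_mass Q| <=
  (2 * pi) ^+ d * expR (- (alpha / (80 * theta ^+ 2 * rho))) +
  eps * gauss_mass Q.
Proof.
move=> Q dn Az z01 Y0 AY l0 QL rho0 psiY th1 normA alpha0 zalpha e0 e2 lamge.
have th0 : 0 < theta by lra.
have Qs : Q^T = Q by rewrite /Q trmx_mul trmxK.
have Qp : posdef Q := posdef_coercive Qs l0 QL.
have G0 := gauss_mass_gt0 Qp; set G := gauss_mass Q in G0 *.
set L := d%:R + ln (1 / eps) in lamge; set Lam := ln (n%:R / eps) in lamge.
pose M := eps / (2 ^+ 9 * L); pose tau := 8 * Lam / M.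
have [[L2 dL eL Lam2] [[nLam eLam M0 ML3] [Ltau ML tauM tau2 lam28]]] :=
  @numeric_bounds R eps theta lambda L Lam M tau d n e0 e2 th1 dn
    erefl erefl erefl erefl lamge.
pose u j := (2 * tau) *: col j (toreal R A).
have uL j : dotp (u j) (u j) <= 4 * lambda * Lam.
  rewrite dotpZl dotpC dotpZl mulrA -expr2; set a := col j _.
  have aa : dotp a a <= theta ^+ 2 / 4.
    apply: le_trans (dotp_le_norm1 a) _.
    have n0 : 0 <= norm1 a by exact: sumr_ge0.
    apply: (@le_trans _ _ ((theta * Num.sqrt (z j 0 * (1 - z j 0))) ^+ 2)).
      by rewrite lerXn2r ?nnegrE ?mulr_ge0 ?sqrtr_ge0 ?(ltW th0)//; exact: normA.
    have v0 : 0 <= z j 0 * (1 - z j 0) by apply: le_trans (zalpha j); exact: ltW.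
    rewrite exprMn sqr_sqrtr// ler_wpM2l ?sqr_ge0//.
    by have := sqr_ge0 (z j 0 - 1 / 2); rewrite sqrrB; lra.
  have := ler_wpM2l (sqr_ge0 (2 * tau)) aa.
  have -> : (2 * tau) ^+ 2 * (theta ^+ 2 / 4) = tau ^+ 2 * theta ^+ 2 by field.
  by move=> H; apply: le_trans H _.
have [h1 h10 H1] := error_bound_sum Qp l0 QL uL e2 L2 dL eL nLam eLam ML tauM.
pose r := 1 / (2 * theta).
have r0 : 0 < r by rewrite divr_gt0// mulr_gt0.
have lr : 7 * Lam <= lambda * r ^+ 2.
  have -> : lambda * r ^+ 2 = lambda / (4 * theta ^+ 2).
    by rewrite /r; field; rewrite gt_eqF.
  by rewrite ler_pdivlMr ?mulr_gt0 ?exprn_gt0//; lra.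
have [h2 h20 H2] :=
  gauss_box_sum_small Qp l0 QL r0 (ltnW dn) e0 e2 nLam eLam lr.
have [K0 HK0] := fourier_inversion Az.
have p0 := @pi_gt0 R; have p2 := @pi_ge2 R.
have hmin0 : 0 < Num.min h1 h2 by rewrite lt_min h10.
(* [K0] validates inversion, the bound on the quotient makes [h] small enough, and [K >= 1] ensures
   [r <= 1 / 2 <= h K]. *)
pose K := (maxn K0 (maxn 1 (Num.bound (2 * pi / Num.min h1 h2))))%N.
have K0K : (K0 <= K)%N by exact: leq_maxl.
have K1 : 1 <= K%:R :> R by rewrite ler1n !leq_max leqnn orbT.
have K2 : 2 * pi / Num.min h1 h2 <= K%:R.
  have H0 : 0 <= 2 * pi / Num.min h1 h2.
    by apply: divr_ge0; [rewrite mulr_ge0// ltW|exact: ltW].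
  apply: ltW; apply: lt_le_trans (archi_boundP H0) _.
  by rewrite ler_nat !leq_max leqnn !orbT.
have NE : K.*2.+1%:R = 2 * K%:R + 1 :> R by rewrite -natr1 -mul2n natrM.
have N0 : 0 < K.*2.+1%:R :> R by rewrite ltr0n.
pose h : R := 2 * pi / K.*2.+1%:R.
have h0 : 0 < h by rewrite divr_gt0// mulr_gt0.
have hmin : h <= Num.min h1 h2.
  rewrite ler_pdivrMr//; move: K2; rewrite ler_pdivrMr// [leRHS]mulrC => K2.
  apply: le_trans K2 _; rewrite ler_pM2l// NE; lra.
move: hmin; rewrite le_min => /andP[hh1 hh2].
have rhK : r <= h * K%:R.
  have r2 : r <= 1 / 2.
    by rewrite ler_pdivrMr ?mulr_gt0//; lra.
  apply: le_trans r2 _; rewrite mulrAC ler_pdivlMr// NE.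
  have : 2 * K%:R <= pi * K%:R :> R by apply: ler_wpM2r => //; lra.
  lra.
have {}H1 := H1 h K h0 hh1; have {}H2 := H2 h K h0 hh2 rhK.
have FI := HK0 K K0K; rewrite -/h in FI.
set S := \sum_(x : {ffun 'I_n -> bool} | A *m bits x == b) bernoulli_pmf z x
  in FI *.
set D0 := expR (- (alpha / _)).
pose f (t : 'cV[R]_d) := if inbox r t then expR (- (quadf Q t / 2)) else 0.
have pt (k : {ffun 'I_d -> 'I_(K.*2.+1)}) :
    Normc.normc (char_fun A z (grid h k) - real_complex R (f (grid h k))) <=
    D0 + error_bound Q u L M (tau * M) (grid h k).
  have eb0 t : 0 <= error_bound Q u L M (tau * M) t.
    rewrite /error_bound ML; apply: addr_ge0; last first.
      by apply: sumr_ge0 => j _; rewrite !mulr_ge0 ?addr_ge0 ?expR_ge0.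
    apply: addr_ge0; last by rewrite !mulr_ge0 ?expR_ge0.
    by apply: mulr_ge0; [lra|exact: expR_ge0].
  rewrite /f; case: ifP => [near|/negbT].
    apply: ler_wpDl; first exact: expR_ge0.
    exact: (char_fun_near z01 th1 normA L2 M0 ML3 Ltau near).
  rewrite /inbox => /forallPn[i0]; rewrite -ltNge => ti.
  apply: ler_wpDr; first exact: eb0.
  rewrite rmorph0 subr0.
  apply: le_trans (char_fun_far z01 alpha0 zalpha (Y0 i0) (AY i0) rho0
    (psiY i0) (grid_bound k i0)) _.
  rewrite ler_expR lerN2 -/h.
  have : r ^+ 2 <= grid h k i0 0 ^+ 2.
    rewrite -[leRHS]real_normK ?num_real// lerXn2r ?nnegrE ?(ltW r0)//.
    exact: ltW.
  move=> rt; have ar : 0 < alpha / (20 * rho) by rewrite divr_gt0// mulr_gt0.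
  have := ler_wpM2l (ltW ar) rt.
  have -> : alpha / (20 * rho) * r ^+ 2 = alpha / (80 * theta ^+ 2 * rho).
    by rewrite /r; field; rewrite !gt_eqF.
  by move=> H; apply: le_trans H _; rewrite mulrAC.
have sumB : Normc.normc (real_complex R ((2 * pi) ^+ d * S - gridsum h K f)) <=
    (2 * pi) ^+ d * D0 + 11 / 32 * eps * G.
  have -> : real_complex R ((2 * pi) ^+ d * S - gridsum h K f) =
    real_complex R (h ^+ d) * \sum_(k : {ffun 'I_d -> 'I_(K.*2.+1)})
      (char_fun A z (grid h k) - real_complex R (f (grid h k))).
    transitivity (real_complex R ((2 * pi) ^+ d * S) -
      real_complex R (gridsum h K f)); first exact: rmorphB.
    rewrite -FI sumrB mulrBr; congr (_ - _).
    transitivity (real_complex R (h ^+ d) * real_complex R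
      (\sum_(k : {ffun 'I_d -> 'I_(K.*2.+1)}) f (grid h k))).
      exact: rmorphM.
    by congr (_ * _); exact: rmorph_sum.
  rewrite Normc.normcM normc_real ger0_norm ?exprn_ge0 ?(ltW h0)//.
  apply: le_trans (ler_wpM2l (exprn_ge0 _ (ltW h0)) (normc_sum_le _ _ _)) _.
  apply: (@le_trans _ _ (h ^+ d * \sum_(k : {ffun 'I_d -> 'I_(K.*2.+1)})
    (D0 + error_bound Q u L M (tau * M) (grid h k)))).
    by rewrite ler_wpM2l ?exprn_ge0 ?(ltW h0)//; apply: ler_sum => k _; exact: pt.
  rewrite big_split mulrDr; apply: lerD; last exact: H1.
  (* The constant [D0] is charged at all [(2 K + 1)^d] points, each of weight [h^d]: in total
     [(2 pi)^d]. *)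
  rewrite sumr_const card_ffun !card_ord -[D0 *+ _]mulr_natr natrX mulrCA -exprMn.
  by rewrite /h divfK ?gt_eqF// mulrC.
rewrite normc_real in sumB.
apply: le_trans (ler_distD (gridsum h K f) _ _) _.
apply: le_trans (lerD sumB H2) _; rewrite -/G.
by have := mulr_gt0 e0 G0; lra.
Qed.

(** The deviation [S - G] is clipped at [eps G] in absolute value: [kappa] absorbs the clipped part,
    [Delta] the excess. *)
Lemma split_error (S G D0 eps : R) : 0 < G -> 0 <= D0 -> 0 < eps ->
  `|S - G| <= D0 + eps * G ->
  exists kappa Delta, [/\ S = kappa * G + Delta,
    1 - eps <= kappa <= 1 + eps & `|Delta| <= D0].
Proof.
move=> G0 D00 e0; rewrite ler_norml => /andP[lo up].
have eG : 0 < eps * G by rewrite mulr_gt0.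
have [h1|h1] := lerP (S - G) (eps * G); last first.
  exists (1 + eps), (S - G - eps * G); split; first by ring.
    by apply/andP; split; lra.
  by rewrite ger0_norm; lra.
have [h2|h2] := lerP (- (eps * G)) (S - G); last first.
  exists (1 - eps), (S - G + eps * G); split; first by ring.
    by apply/andP; split; lra.
  by rewrite ler0_norm; lra.
exists (S / G), 0; split; first by rewrite divfK ?gt_eqF// addr0.
  by rewrite ler_pdivlMr// ler_pdivrMr//; apply/andP; split; lra.
by rewrite normr0.
Qed.

End Assembly.

Theorem theorem2p6 (R : realType) :
  exists gamma : R, 0 < gamma /\
  forall (d n : nat) (A : 'M[int]_(d, n)) (b : 'cV[int]_d) (z : 'cV[R]_n)
    (Y : 'I_d -> {fset 'cV[int]_n}) (lambda rho theta alpha : R),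
  \rank (toreal R A) = d ->
  (d < n)%N ->
  polytope01 R A b !=set0 ->
  range (fun y : 'cV[int]_n => A *m y) = [set: 'cV[int]_d] ->
  polytope01 R A b z ->
  (forall x : 'cV[R]_n, polytope01 R A b x -> entropy x <= entropy z) ->
  (forall i : 'I_d, Y i != fset0) ->
  (forall (i : 'I_d) (y : 'cV[int]_n), y \in Y i -> A *m y = delta_mx i ord0) ->
  0 < lambda ->
  (forall t : 'cV[R]_d, lambda * norm2 t ^+ 2 <= qform A z t) ->
  0 < rho ->
  (forall (i : 'I_d) (x : 'cV[R]_n), psi (Y i) x <= rho * norm2 x ^+ 2) ->
  1 <= theta ->
  (forall j : 'I_n, norm1 (col j (toreal R A)) <=
     theta * Num.sqrt (z j ord0 * (1 - z j ord0))) ->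
  0 < alpha -> alpha <= 1 / 4 ->
  (forall j : 'I_n, alpha <= z j ord0 * (1 - z j ord0)) ->
  forall epsilon : R, 0 < epsilon -> epsilon <= 1 / 2 ->
  gamma * epsilon ^- 2 * theta ^+ 2 * (d%:R + ln (1 / epsilon)) ^+ 2
    * ln (n%:R / epsilon) <= lambda ->
  exists kappa Delta : R,
    [/\ #|` fset_set (polytope01 R A b `&` vectors01 R n)|%:R =
          expR (entropy z) *
          (kappa / ((2 * pi) `^ (d%:R / 2)
                    * Num.sqrt (\det (scaledmx A z *m (scaledmx A z)^T)))
           + Delta),
        1 - epsilon <= kappa <= 1 + epsilon &
        `|Delta| <= expR (- (alpha / (80 * theta ^+ 2 * rho)))].
Proof.
exists (2 ^+ 22); split; first by rewrite exprn_gt0.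
move=> d n A b z Y lambda rho theta alpha _ dn _ _ zP zmax Y0 AY l0 qL rho0
  psiY th1 normA alpha0 _ zalpha eps e0 e2 lamge.
have [Az z01] := zP.
pose Q := scaledmx A z *m (scaledmx A z)^T.
have QL t : lambda * dotp t t <= quadf Q t / 2.
  by rewrite -norm2_sqr -qform_quadf.
have Qs : Q^T = Q by rewrite /Q trmx_mul trmxK.
have Qp : posdef Q := posdef_coercive Qs l0 QL.
have p20 : 0 < 2 * pi :> R by rewrite mulr_gt0// pi_gt0.
have P0 : 0 < (2 * pi) ^+ d :> R by rewrite exprn_gt0.
have := local_limit dn Az z01 Y0 AY l0 QL rho0 psiY th1 normA alpha0 zalpha
  e0 e2 lamge.
rewrite -/Q; set S := \sum_(x | _) _; set D0 := expR _ => H.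
(* [(2 pi)^(d / 2)] is rewritten as [(2 pi)^d / (2 pi)^(d / 2)] so that the factor from inversion
   cancels. *)
have massE : gauss_mass Q = (2 * pi) ^+ d *
    (1 / ((2 * pi) `^ (d%:R / 2) * Num.sqrt (\det Q))).
  have -> : (2 * pi) `^ (d%:R / 2) = Num.sqrt (2 * pi) ^+ d :> R.
    by rewrite [d%:R / 2]mulrC powRrM (powR12_sqrt (ltW p20)) powR_mulrn ?sqrtr_ge0.
  have s0 : 0 < Num.sqrt (2 * pi) ^+ d :> R by rewrite exprn_gt0// sqrtr_gt0.
  have D1 : 0 < Num.sqrt (\det Q) by rewrite sqrtr_gt0 posdef_det.
  rewrite /gauss_mass -{2}(sqr_sqrtr (ltW p20)) exprAC expr2.
  by field; rewrite !gt_eqF.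
set g := 1 / _ in massE.
have g0 : 0 < g by have := gauss_mass_gt0 Qp; rewrite massE pmulr_rgt0.
have Sg : `|S - g| <= D0 + eps * g.
  rewrite -(ler_pM2l P0) -{1}(ger0_norm (ltW P0)) -normrM mulrBr -massE.
  by apply: le_trans H _; rewrite massE [leRHS]mulrDr; apply: lerD => //; rewrite mulrCA.
have [kappa [Delta [SE kE DE]]] :=
  split_error g0 (expR_ge0 _) e0 Sg.
exists kappa, Delta; split => //.
rewrite (count_polytope01 zP zmax alpha0 zalpha) -/S SE /g.
by rewrite mulrA mulr1.
Qed.
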